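(* Let $K=\bigcup_{\ell=1}^L[a_\ell,b_\ell]$ with $-1=a_1<b_1<a_2<b_2<\cdots<a_L<b_L=1$, let $w$ be a positive continuous function on $K$, and let $N$ be a nonnegative integer. For each integer $d\ge N$, let $\mathcal{V}_{N,d}^K$ be any minimizer of $|||P|||_d$ over all monic real polynomials $P$ of degree $N$. Then the sequence $(\mathcal{V}_{N,d}^K)_{d\ge N}$ admits a subsequence converging (with respect to any of the equivalent norms on the space of polynomials of degree at most $N$) to a minimizer $\mathcal{U}_N^K$ of $\|P/w\|_{L_1(K)}$ over all monic real polynomials $P$ of degree $N$. Moreover, if the problem of minimizing $\|P/w\|_{L_1(K)}$ over all monic real polynomials $P$ of degree $N$ has a unique minimizer $\mathcal{U}_N^K$, then the whole sequence $(\mathcal{V}_{N,d}^K)_{d\ge N}$ converges to $\mathcal{U}_N^K$ as $d\to\infty$.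
   Context: Polynomials $P$ of degree at most $N$ are written $P=\sum_{n=0}^Np_nT_n$ with $\mathbf{p}=(p_0,\dots,p_N)\in\mathbb{R}^{N+1}$, where $T_n(\cos\theta)=\cos(n\theta)$; $U_n$ is the Chebyshev polynomial of the second kind, $U_n(\cos\theta)=\sin((n+1)\theta)/\sin\theta$. The weighted $L_1$-norm is $\|P/w\|_{L_1(K)}=\sum_{\ell=1}^L\int_{a_\ell}^{b_\ell}\frac{|P(t)|}{w(t)}\,dt$. For $x\in[-1,1]$, $P_\ell(x)=P\left(\frac{(b_\ell-a_\ell)x+a_\ell+b_\ell}{2}\right)$ and $w_\ell(x)=w\left(\frac{(b_\ell-a_\ell)x+a_\ell+b_\ell}{2}\right)$. The matrix $\mathbf{W}^\ell\in\mathbb{R}^{(N+1)\times(N+1)}$ represents the linear map sending the Chebyshev coefficients $\mathbf{p}$ of $P$ to the coefficients of $P_\ell$ in the second-kind basis, i.e. $P_\ell=\sum_{n=0}^N(\mathbf{W}^\ell\mathbf{p})_nU_n$. The matrix $\mathbf{J}^{\ell,d}\in\mathbb{R}^{(d+1)\times(N+1)}$ has entries $J^{\ell,d}_{k,n}=\int_0^\pi\frac{\cos(k\theta)\sin((n+1)\theta)}{w_\ell(\cos\theta)}\,d\theta$, $0\le k\le d$, $0\le n\le N$. For $\mathbf{y}=(y_0,\dots,y_d)\in\mathbb{R}^{d+1}$, $\mathbf{Toep}_d(\mathbf{y})\in\mathbb{R}^{(d+1)\times(d+1)}$ is the symmetric Toeplitz matrix with $(i,j)$ entry $y_{|i-j|}$,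 and $\succeq0$ means positive semidefinite. For $d\ge N$ and a real polynomial $P$ of degree at most $N$ with Chebyshev coefficient vector $\mathbf{p}$, the ersatz norm $|||P|||_d$ is the minimum of $\sum_{\ell=1}^L\frac{b_\ell-a_\ell}{2}(y_0^{\ell,+}+y_0^{\ell,-})$ over all $\mathbf{y}^{1,\pm},\dots,\mathbf{y}^{L,\pm}\in\mathbb{R}^{d+1}$ subject to $\mathbf{y}^{\ell,+}-\mathbf{y}^{\ell,-}=\mathbf{J}^{\ell,d}\mathbf{W}^\ell\mathbf{p}$, $\mathbf{Toep}_d(\mathbf{y}^{\ell,+})\succeq0$ and $\mathbf{Toep}_d(\mathbf{y}^{\ell,-})\succeq0$ for all $\ell=1,\dots,L$. *)

(* Defs.v *)
From HB Require Import structures.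
From mathcomp Require Import all_boot all_order all_algebra.
From mathcomp Require Import all_classical all_reals all_analysis.
From mathcomp Require Import ring lra zify.
Set Implicit Arguments.
Unset Strict Implicit.
Unset Printing Implicit Defensive.
Import Order.TTheory GRing.Theory Num.Theory.
Import numFieldNormedType.Exports.
Local Open Scope classical_set_scope.
Local Open Scope ring_scope.

Section Chebyshev.
Variable R : realType.
Implicit Types (a b x t : R) (n N : nat) (P : {poly R}) (B : nat -> {poly R}).

Fixpoint chebT n : {poly R} :=
  if n is n'.+1 then
    if n' is m.+1 then 2 *: 'X * chebT n' - chebT m else 'X
  else 1.

Fixpoint chebU n : {poly R} :=
  if n is n'.+1 then
    if n' is m.+1 then 2 *: 'X * chebU n' - chebU m else 2 *: 'X
  else 1.

Lemma horner_chebT n t : (chebT n).[cos t] = cos (t *+ n).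
Proof.
suff: (chebT n).[cos t] = cos (t *+ n) /\
      (chebT n.+1).[cos t] = cos (t *+ n.+1) by case.
elim: n => [|n [IH1 IH2]].
  by rewrite /= hornerC hornerX mulr0n mulr1n cos0.
split=> //.
have -> : chebT n.+2 = 2 *: 'X * chebT n.+1 - chebT n by [].
rewrite !hornerE IH1 IH2.
have -> : t *+ n.+2 = t *+ n.+1 + t by rewrite -mulrSr.
have -> : t *+ n = t *+ n.+1 - t by rewrite mulrSr addrK.
by rewrite !cosD cosN sinN; ring.
Qed.

Lemma horner_chebU n t : (chebU n).[cos t] * sin t = sin (t *+ n.+1).
Proof.
suff: (chebU n).[cos t] * sin t = sin (t *+ n.+1) /\
      (chebU n.+1).[cos t] * sin t = sin (t *+ n.+2) by case.
elim: n => [|n [IH1 IH2]].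
  rewrite /= !hornerE mulr1n; split=> //.
  by rewrite mulr2n sinD; ring.
split=> //.
have -> : chebU n.+2 = 2 *: 'X * chebU n.+1 - chebU n by [].
rewrite !hornerE mulrBl IH1 -[_ * _ * sin t]mulrA IH2.
have -> : t *+ n.+3 = t *+ n.+2 + t by rewrite -mulrSr.
have -> : t *+ n.+1 = t *+ n.+2 - t by rewrite [t *+ n.+2]mulrSr addrK.
by rewrite !sinD cosN sinN; ring.
Qed.

Lemma size_chebT n : size (chebT n) = n.+1.
Proof.
suff: size (chebT n) = n.+1 /\ size (chebT n.+1) = n.+2 by case.
elim: n => [|n [IH1 IH2]]; first by rewrite /= size_poly1 size_polyX.
split=> //.
have -> : chebT n.+2 = 2 *: 'X * chebT n.+1 - chebT n by [].
have T0 : chebT n.+1 != 0 by rewrite -size_poly_gt0 IH2.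
have E : size (2 *: 'X * chebT n.+1 : {poly R}) = n.+3.
  by rewrite -scalerAl size_scale ?pnatr_eq0// mulrC size_mulX// IH2.
by rewrite size_polyDl ?E// size_polyN IH1 ltnS ltnW.
Qed.

Lemma size_chebU n : size (chebU n) = n.+1.
Proof.
suff: size (chebU n) = n.+1 /\ size (chebU n.+1) = n.+2 by case.
elim: n => [|n [IH1 IH2]].
  by rewrite /= size_poly1 size_scale ?pnatr_eq0// size_polyX.
split=> //.
have -> : chebU n.+2 = 2 *: 'X * chebU n.+1 - chebU n by [].
have T0 : chebU n.+1 != 0 by rewrite -size_poly_gt0 IH2.
have E : size (2 *: 'X * chebU n.+1 : {poly R}) = n.+3.
  by rewrite -scalerAl size_scale ?pnatr_eq0// mulrC size_mulX// IH2.
by rewrite size_polyDl ?E// size_polyN IH1 ltnS ltnW.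
Qed.

Definition basis_mx N B : 'M[R]_N.+1 := \matrix_(i, n) (B n)`_i.

(* The coordinate vector of P (of degree at most N) in the basis B_0, .., B_N;
   meaningful when this is a basis, see polycoordK and polycoord_uniq. *)
Definition polycoord N B P : 'cV[R]_N.+1 :=
  invmx (basis_mx N B) *m \col_i P`_i.

Lemma basis_mx_unit N B : (forall n, size (B n) = n.+1) ->
  basis_mx N B \in unitmx.
Proof.
move=> sB; rewrite -unitmx_tr unitmxE det_trig.
  rewrite unitfE prodf_seq_neq0; apply/allP => i _ /=.
  rewrite !mxE; have -> : (B i)`_i = lead_coef (B i) by rewrite lead_coefE sB.
  by rewrite lead_coef_eq0 -size_poly_gt0 sB.
by apply/is_trig_mxP => i j ij; rewrite !mxE nth_default// sB.
Qed.

Lemma mul_basis_mx N B (p : 'cV[R]_N.+1) :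
  basis_mx N B *m p = \col_i (\sum_(n < N.+1) p n 0 *: B n)`_i.
Proof.
apply/matrixP => i j; rewrite !mxE ord1 coef_sum; apply: eq_bigr => n _.
by rewrite !mxE coefZ mulrC.
Qed.

Lemma polycoordK N B P : (forall n, size (B n) = n.+1) -> (size P <= N.+1)%N ->
  \sum_(n < N.+1) polycoord N B P n 0 *: B n = P.
Proof.
move=> sB sP.
have := mul_basis_mx B (polycoord N B P).
rewrite /polycoord mulKVmx ?basis_mx_unit// => E.
apply/polyP => i; case: (ltnP i N.+1) => iN.
  by have /matrixP/(_ (Ordinal iN) 0) := E; rewrite !mxE => ->.
rewrite (@nth_default _ 0 P) ?(leq_trans sP)// nth_default//.
apply: leq_trans iN; apply: leq_trans (size_sum _ _ _) _.
apply/bigmax_leqP => n _.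
by rewrite (leq_trans (size_scale_leq _ _))// sB.
Qed.

Lemma polycoord_uniq N B (p : 'cV[R]_N.+1) : (forall n, size (B n) = n.+1) ->
  polycoord N B (\sum_(n < N.+1) p n 0 *: B n) = p.
Proof.
by move=> sB; rewrite /polycoord -mul_basis_mx mulKmx ?basis_mx_unit.
Qed.

Definition affine a b x : R := ((b - a) * x + a + b) / 2.

Definition poly_pullback a b P : {poly R} :=
  P \Po (((b - a) / 2) *: 'X + ((a + b) / 2)%:P).

Lemma horner_poly_pullback a b P x :
  (poly_pullback a b P).[x] = P.[affine a b x].
Proof.
rewrite horner_comp !hornerE /affine; congr horner.
by rewrite -addrA [RHS]mulrDl [in RHS]mulrAC.
Qed.

Definition chebW a b N : 'M[R]_N.+1 :=
  \matrix_(i, n) polycoord N chebU (poly_pullback a b (chebT n)) i 0.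

Lemma chebWP a b N (p : 'cV[R]_N.+1) :
  poly_pullback a b (\sum_(n < N.+1) p n 0 *: chebT n) =
  \sum_(n < N.+1) (chebW a b N *m p) n 0 *: chebU n.
Proof.
have sP n : (size (poly_pullback a b (chebT n)) <= n.+1)%N.
  rewrite (leq_trans (size_comp_poly_leq _ _))// size_chebT ltnS /=.
  set q := (X in size X).
  have sq : (size q <= 2)%N.
    rewrite (leq_trans (size_polyD _ _))// geq_max.
    rewrite (leq_trans (size_scale_leq _ _)) ?size_polyX//=.
    by rewrite (leq_trans (size_polyC_leq1 _)).
  by rewrite -[leqRHS]muln1 leq_mul2l -subn1 leq_subLR sq orbT.
rewrite /poly_pullback raddf_sum /=.
under eq_bigr => n _.
  rewrite linearZ /= -/(poly_pullback a b (chebT n)).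
  rewrite -(@polycoordK N chebU (poly_pullback a b (chebT n)) size_chebU); last first.
    exact: leq_trans (sP n) (ltn_ord n).
  rewrite scaler_sumr.
over.
rewrite exchange_big /=; apply: eq_bigr => i _.
rewrite !mxE scaler_suml; apply: eq_bigr => n _.
by rewrite !mxE scalerA mulrC.
Qed.

End Chebyshev.

Section Toeplitz.
Variable R : realType.

Definition psd n (A : 'M[R]_n) :=
  A^T = A /\ forall v : 'cV[R]_n, 0 <= (v^T *m A *m v) 0 0.

Definition Toep d (y : 'cV[R]_d.+1) : 'M[R]_d.+1 :=
  \matrix_(i, j) y (inord `|i - j|%N) 0.

Lemma ToepE d (y : 'cV[R]_d.+1) (i j : 'I_d.+1) (k : 'I_d.+1) :
  (i + k = j)%N -> Toep y i j = y k 0 /\ Toep y j i = y k 0.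
Proof.
move=> ikj; rewrite !mxE.
have e : `|i - j|%N = k by rewrite -ikj; lia.
have e' : `|j - i|%N = k by rewrite -ikj; lia.
by rewrite e e' inord_val.
Qed.

Lemma tr_Toep d (y : 'cV[R]_d.+1) : (Toep y)^T = Toep y.
Proof. by apply/matrixP => i j; rewrite !mxE distnC. Qed.

Lemma Toep_quadE d (y v : 'cV[R]_d.+1) : (v^T *m Toep y *m v) 0 0 =
  \sum_(j < d.+1) \sum_(i < d.+1) v i 0 * y (inord `|i - j|%N) 0 * v j 0.
Proof.
rewrite !mxE; apply: eq_bigr => j _; rewrite !mxE mulr_suml.
by apply: eq_bigr => i _; rewrite !mxE.
Qed.

Local Lemma mxaddE m n (A B : 'M[R]_(m, n)) i j : (A + B) i j = A i j + B i j.
Proof. by rewrite mxE. Qed.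

Local Lemma mxscaleE m n s (A : 'M[R]_(m, n)) i j : (s *: A) i j = s * A i j.
Proof. by rewrite mxE. Qed.

Lemma psd_Toep_le d (y : 'cV[R]_d.+1) k : psd (Toep y) -> `|y k 0| <= y 0 0.
Proof.
move=> [_ y0].
have [e1 e2] : Toep y ord0 k = y k 0 /\ Toep y k ord0 = y k 0.
  exact: ToepE.
have [e3 _] : Toep y k k = y 0 0 /\ Toep y k k = y 0 0.
  by apply: ToepE; rewrite addn0.
have [e4 _] : Toep y ord0 ord0 = y 0 0 /\ Toep y ord0 ord0 = y 0 0.
  exact: ToepE.
have E (i j : 'I_d.+1) :
    ((delta_mx i 0 : 'cV[R]_d.+1)^T *m Toep y *m (delta_mx j 0 : 'cV[R]_d.+1))
    0 0 = Toep y i j.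
  by rewrite trmx_delta -rowE -colE !mxE.
have H s : s * s = 1 -> 0 <= 2 * y 0 0 + 2 * s * y k 0.
  move=> ss; have := y0 (delta_mx k 0 + s *: delta_mx ord0 0).
  have -> : (delta_mx k 0 + s *: delta_mx ord0 0 : 'cV[R]_d.+1)^T =
      (delta_mx k 0 : 'cV_d.+1)^T + s *: (delta_mx ord0 0 : 'cV_d.+1)^T.
    by apply/matrixP => i j; rewrite !mxE.
  rewrite !mulmxDl !mulmxDr -!scalemxAl -!scalemxAr.
  rewrite !mxaddE !mxscaleE !E e1 e2 e3 e4.
  by rewrite [s * (s * _)]mulrA ss; lra.
have h1 := H 1 (mulr1 1); have h2 := H (-1) (etrans (mulrNN 1 1) (mulr1 1)).
by rewrite ler_norml; apply/andP; split; lra.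
Qed.

Lemma sum_continuous (T : topologicalType) (I : Type) (r : seq I)
    (f : I -> T -> R) :
  (forall i, continuous (f i)) -> continuous (fun x => \sum_(i <- r) f i x).
Proof.
move=> fc x; elim: r => [|i r IH].
  rewrite (_ : (fun _ => _) = cst 0); first exact: cst_continuous.
  by apply/funext => y; rewrite big_nil.
rewrite (_ : (fun _ => _) = f i \+ fun y => \sum_(j <- r) f j y).
  by apply: continuousD => //; exact: fc.
by apply/funext => y; rewrite big_cons.
Qed.

Lemma closed_psd_Toep d (c : 'cV[R]_d.+1) :
  closed [set u : 'rV[R]_d.+1 | psd (Toep (u^T - c))].
Proof.
have -> : [set u : 'rV[R]_d.+1 | psd (Toep (u^T - c))] =
    \bigcap_(v in [set: 'cV[R]_d.+1])
      [set u : 'rV[R]_d.+1 | 0 <= (v^T *m Toep (u^T - c) *m v) 0 0].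
  apply/seteqP; split => u /=.
    by move=> [_ h] v _; exact: h.
  by move=> h; split; [exact: tr_Toep|move=> v; exact: h].
apply: closed_bigI => v _.
apply: (@preimage_closed _ _
  (fun u : 'rV[R]_d.+1 => (v^T *m Toep (u^T - c) *m v) 0 0)
  [set x | 0 <= x]); last exact: closed_ge.
move=> u _.
rewrite (_ : (fun _ => _) = fun u : 'rV[R]_d.+1 =>
  \sum_(j < d.+1) \sum_(i < d.+1)
    v i 0 * (u 0 (inord `|i - j|%N) - c (inord `|i - j|%N) 0) * v j 0); last first.
  apply/funext => u'; rewrite Toep_quadE.
  by apply: eq_bigr => j _; apply: eq_bigr => i _; rewrite !mxE.
move: u; apply: sum_continuous => j; apply: sum_continuous => i u.
have uF : Filter (nbhs u) by exact: nbhs_filter.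
apply: (@cvgM _ _ (nbhs u)); last exact: cvg_cst.
apply: (@cvgM _ _ (nbhs u)); first exact: cvg_cst.
apply: (@cvgB _ _ _ (nbhs u)); last exact: cvg_cst.
exact: coord_continuous.
Qed.

Lemma psd_shift d (c : 'cV[R]_d.+1) :
  exists2 y : 'cV[R]_d.+1, psd (Toep y) & psd (Toep (y - c)).
Proof.
pose e0 : 'cV[R]_d.+1 := delta_mx ord0 0.
have Te0 : Toep e0 = 1%:M.
  apply/matrixP => i j; rewrite !mxE andbT.
  have hij : (`|i - j| < d.+1)%N by have := ltn_ord i; have := ltn_ord j; lia.
  rewrite -val_eqE /= inordK// -val_eqE /=; congr (_%:R); congr nat_of_bool.
  by apply/idP/idP => /eqP h; apply/eqP; lia.
pose m := \sum_k `|c k 0|.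
have cm k : `|c k 0| <= m by rewrite /m (bigD1 k)//= lerDl sumr_ge0.
have m0 : 0 <= m by exact: le_trans (normr_ge0 _) (cm ord0).
pose M := m *+ d.+1.
have e0psd : psd (Toep (M *: e0)).
  split=> [|v]; first exact: tr_Toep.
  have -> : Toep (M *: e0) = M *: Toep e0 by apply/matrixP => i j; rewrite !mxE.
  rewrite Te0 -scalemxAr mulmx1 -scalemxAl !mxE mulr_ge0 ?mulrn_wge0//.
  by apply: sumr_ge0 => i _; rewrite !mxE -expr2 sqr_ge0.
exists (c + M *: e0); last by rewrite addrC addKr.
split=> [|v]; first exact: tr_Toep.
have -> : Toep (c + M *: e0) = Toep c + M *: 1%:M.
  by rewrite -Te0; apply/matrixP => i j; rewrite !mxE.
rewrite mulmxDr mulmxDl -scalemxAr mulmx1 -scalemxAl.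
rewrite mxaddE Toep_quadE.
set q : R := \sum_i v i 0 ^+ 2.
have -> : (M *: (v^T *m v)) 0 0 = M * q.
  rewrite !mxE; congr (_ * _); apply: eq_bigr => i _.
  by rewrite !mxE expr2.
have -> : M * q = \sum_(j < d.+1) \sum_(i < d.+1)
    m * ((v i 0 ^+ 2 + v j 0 ^+ 2) / 2).
  under eq_bigr => j _.
    rewrite -mulr_sumr -mulr_suml big_split /= sumr_const card_ord -/q.
  over.
  rewrite -mulr_sumr -mulr_suml big_split /= sumr_const card_ord.
  rewrite sumrMnl -/q /M -[m *+ _]mulr_natr -[q *+ _]mulr_natr.
  by move: (d.+1%:R : R) => D; field.
rewrite -big_split sumr_ge0// => j _; rewrite -big_split sumr_ge0// => i _ /=.
have := cm (inord `|i - j|%N); move: (c _ _) => z.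
move: (v i 0) (v j 0) => x x' zm.
have := ler_norm (- (x * z * x')); rewrite normrN !normrM => h1.
have h2 : `|x| * `|z| * `|x'| <= m * (`|x| * `|x'|).
  by rewrite mulrAC mulrC ler_wpM2r// mulr_ge0.
have h3 : `|x| * `|x'| <= (x ^+ 2 + x' ^+ 2) / 2.
  rewrite -[x ^+ 2]real_normK ?num_real// -[x' ^+ 2]real_normK ?num_real//.
  have := sqr_ge0 (`|x| - `|x'|); nra.
have h4 : m * (`|x| * `|x'|) <= m * ((x ^+ 2 + x' ^+ 2) / 2).
  exact: ler_wpM2l.
lra.
Qed.

Lemma psd_Toep_min d (c : 'cV[R]_d.+1) : exists y : 'cV[R]_d.+1,
  [/\ psd (Toep y), psd (Toep (y - c)) &
    forall z, psd (Toep z) -> psd (Toep (z - c)) -> y 0 0 <= z 0 0].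
Proof.
have [y0 py0 py0c] := psd_shift c.
pose A : set 'rV[R]_d.+1 := [set u | psd (Toep (u^T - 0))] `&`
  [set u | psd (Toep (u^T - c))].
pose B : set 'rV[R]_d.+1 := A `&`
  [set u | forall i, u ord0 i \in `[- y0 0 0, y0 0 0]].
have cB : compact B.
  rewrite /B setIC; apply: compact_closedI; last first.
    by apply: closedI; exact: closed_psd_Toep.
  apply: (@rV_compact _ _ (fun=> `[- y0 0 0, y0 0 0]%classic)) => i.
  exact: segment_compact.
have inB (z : 'cV[R]_d.+1) : psd (Toep z) -> psd (Toep (z - c)) ->
    z 0 0 <= y0 0 0 -> B z^T.
  move=> pz pzc zy; split; first by split; rewrite /= trmxK ?subr0.
  move=> i; rewrite /= mxE in_itv /= -ler_norml.
  exact: le_trans (psd_Toep_le i pz) zy.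
have [||u] := @compact_EVT_min _ R (fun u : 'rV[R]_d.+1 => u 0 0) B _ cB.
- by exists y0^T; exact: inB.
- by apply: continuous_subspaceT => u; exact: coord_continuous.
rewrite inE => -[[/= pu puc] uB] umin; exists u^T.
rewrite subr0 in pu; split=> // z pz pzc.
rewrite mxE; have [zy|/ltW yz] := leP (z 0 0) (y0 0 0).
  by have := umin z^T; rewrite inE mxE; apply; exact: inB.
by have := uB 0; rewrite in_itv /= => /andP[_ /le_trans]; apply.
Qed.

End Toeplitz.

Section ErsatzNorm.
Variable R : realType.
(* The intervals are [a l, b l] for l < L.+1, so their number is positive. *)
Variables (L : nat) (a b : 'I_L.+1 -> R) (w : R -> R).
Implicit Types (N d : nat) (P : {poly R}).

Definition union_itv : set R := \bigcup_(l in [set: 'I_L.+1]) `[a l, b l]%classic.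

Definition L1norm P : R :=
  \sum_(l < L.+1)
    \int[lebesgue_measure]_(t in `[a l, b l]) (`|P.[t]| / w t).

Definition chebJ N d (l : 'I_L.+1) : 'M[R]_(d.+1, N.+1) :=
  \matrix_(k, n) \int[lebesgue_measure]_(t in `[0, pi])
    (cos (t *+ k) * sin (t *+ n.+1) / w (affine (a l) (b l) (cos t))).

Definition ersatz_feasible N d P (yp ym : 'I_L.+1 -> 'cV[R]_d.+1) :=
  forall l, [/\ yp l - ym l =
                  chebJ N d l *m chebW (a l) (b l) N *m polycoord N (@chebT R) P,
                psd (Toep (yp l))
              & psd (Toep (ym l))].

Definition ersatz_objective d (yp ym : 'I_L.+1 -> 'cV[R]_d.+1) : R :=
  \sum_(l < L.+1) (b l - a l) / 2 * (yp l ord0 0 + ym l ord0 0).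

Definition ersatz_values N d P : set R :=
  [set v | exists yp ym : 'I_L.+1 -> 'cV[R]_d.+1,
     ersatz_feasible N P yp ym /\ v = ersatz_objective yp ym].

(* The infimum is a minimum, see ersatz_norm_min below. *)
Definition ersatz_norm N d P : R := inf (ersatz_values N d P).

Lemma ersatz_norm_min N d P : (forall l, a l <= b l) ->
  ersatz_values N d P (ersatz_norm N d P) /\
  lbound (ersatz_values N d P) (ersatz_norm N d P).
Proof.
move=> ab.
pose c l : 'cV[R]_d.+1 :=
  chebJ N d l *m chebW (a l) (b l) N *m polycoord N (@chebT R) P.
have /choice[y yP] l := psd_Toep_min (c l).
pose yc l := y l - c l.
have vy : ersatz_values N d P (ersatz_objective y yc).
  exists y, yc; split=> // l; have [py pyc _] := yP l.
  by split=> //; rewrite /yc subKr.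
have lby : lbound (ersatz_values N d P) (ersatz_objective y yc).
  move=> _ [yp [ym [f ->]]]; apply: ler_sum => l _.
  rewrite ler_wpM2l ?divr_ge0 ?subr_ge0//.
  have [e pp pm] := f l; have [_ _ ymin] := yP l.
  have eym : ym l = yp l - c l by rewrite /c -e subKr.
  rewrite eym in pm *; have := ymin _ pp pm.
  rewrite /yc !mxE; lra.
suff -> : ersatz_norm N d P = ersatz_objective y yc by [].
apply/eqP; rewrite eq_le; apply/andP; split.
  by apply: ge_inf => //; exists (ersatz_objective y yc).
by apply: lb_le_inf => //; exists (ersatz_objective y yc).
Qed.

End ErsatzNorm.

Section Minimizers.
Variable R : realType.
Implicit Types (N : nat) (P Q U : {poly R}) (nrm : {poly R} -> R).

Definition monic_deg N P := P \is monic /\ size P = N.+1.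

Definition monic_minimizer N (F : {poly R} -> R) U :=
  monic_deg N U /\ forall P, monic_deg N P -> F U <= F P.

(* nrm restricts to a norm on the polynomials of degree at most N;
   its values on other polynomials are irrelevant. *)
Definition poly_norm N nrm :=
  [/\ forall P, (size P <= N.+1)%N -> nrm P = 0 -> P = 0,
      forall c P, (size P <= N.+1)%N -> nrm (c *: P) = `|c| * nrm P
    & forall P Q, (size P <= N.+1)%N -> (size Q <= N.+1)%N ->
        nrm (P + Q) <= nrm P + nrm Q].

(* Convergence for every norm on the polynomials of degree at most N. *)
Definition poly_cvg N (V : nat -> {poly R}) U :=
  forall nrm, poly_norm N nrm -> nrm (V k - U) @[k --> \oo] --> (0 : R).

End Minimizers.

(* Main.v *)
Require Import Defs.
From HB Require Import structures.
From mathcomp Require Import all_boot all_order all_algebra.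
From mathcomp Require Import all_classical all_reals all_analysis.
From mathcomp Require Import ring lra zify.
Set Implicit Arguments.
Unset Strict Implicit.
Unset Printing Implicit Defensive.
Import Order.TTheory GRing.Theory Num.Theory.
Import numFieldNormedType.Exports.
Local Open Scope classical_set_scope.
Local Open Scope ring_scope.

(* Fix one interval and put [g theta = P(t) sin theta / w(t)], with
   [t = affine a b (cos theta)]. The constraint on [y+ - y-] says that this is
   the vector of the first [d + 1] cosine moments of [g], and
   [(b - a) / 2 * \int |g|] is the contribution of the interval to [L1norm P].
   The moments of the positive and negative parts of [g] are feasible, so
   [ersatz_norm P <= L1norm P]. Conversely, testing [Toep y >= 0] on the vectors
   [cos (i theta)] and [sin (i theta)] shows that the Fejer mean of [y] is a
   nonnegative function with integral [y 0]; hence [y+ 0 + y- 0] is at least the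
   integral of the absolute value of the Fejer mean of the moments of [g], which
   converges uniformly to [g] by a Korovkin argument. By linearity in [P] the
   error is at most [e_d * coef_norm P], with [e_d --> 0], so
   [L1norm P <= ersatz_norm P + e_d * coef_norm P] uniformly in [P]. Since
   [L1norm] is a norm, the [V d] are bounded, and every limit point of them
   minimizes [L1norm]. *)

(** * Continuity relative to a subset of the line *)

Section WithinContinuity.
Variable R : realType.
Implicit Types (f g : R -> R) (A B : set R).

Lemma within_continuous_comp2 A B f g : (forall x, A x -> B (f x)) ->
  {within A, continuous f} -> {within B, continuous g} ->
  {within A, continuous (g \o f)}.
Proof.
move=> AB /subspace_continuousP cf /subspace_continuousP cg.
apply/subspace_continuousP => x Ax; apply: cvg_trans; last exact: cg (AB _ Ax).
move=> U hU.
have h : \forall y \near x, A y -> B (f y) -> U (g (f y)) := cf x Ax _ hU.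
change (\forall y \near x, A y -> U (g (f y))).
by apply: filterS h => y h Ay; apply: h => //; exact: AB.
Qed.

Lemma within_continuousM A f g : {within A, continuous f} ->
  {within A, continuous g} -> {within A, continuous (fun x => f x * g x)}.
Proof. by move=> cf cg x; apply: continuousM; [exact: cf|exact: cg]. Qed.

Lemma within_continuous_norm A f : {within A, continuous f} ->
  {within A, continuous (fun x => `|f x|)}.
Proof. by move=> cf x; apply: cvg_norm; exact: cf. Qed.

Lemma within_continuousV A f : (forall x, A x -> f x != 0) ->
  {within A, continuous f} -> {within A, continuous (fun x => (f x)^-1)}.
Proof.
move=> f0 /subspace_continuousP cf; apply/subspace_continuousP => x Ax.
by apply: cvgV; [exact: f0|exact: cf].
Qed.

Lemma within_continuous_cst A (c : R) : {within A, continuous (fun=> c)}.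
Proof. by apply: continuous_subspaceT => x; exact: cvg_cst. Qed.

Lemma within_continuous_sum A (I : Type) (r : seq I) (F : I -> R -> R) :
  (forall i, {within A, continuous (F i)}) ->
  {within A, continuous (fun x => \sum_(i <- r) F i x)}.
Proof. by move=> cF; exact: sum_continuous. Qed.

End WithinContinuity.

(** * Integrals of continuous functions over a segment *)

Section IntegralsOfContinuousFunctions.
Variables (R : realType) (a b : R).
Implicit Types (f g : R -> R).
Local Notation mu := (@lebesgue_measure R).
Local Notation continuous_on f := {within `[a, b], continuous f}.
Local Notation "'\int' f" := (\int[mu]_(t in `[a, b]) f t) (at level 36).

Lemma within_itv_integrable f : continuous_on f ->
  mu.-integrable `[a, b] (EFin \o f).
Proof. by apply: continuous_compact_integrable; exact: segment_compact. Qed.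

Lemma itv_RintegralD f g : continuous_on f -> continuous_on g ->
  \int (fun t => f t + g t) = \int f + \int g.
Proof. by move=> cf cg; rewrite RintegralD//; exact: within_itv_integrable. Qed.

Lemma itv_RintegralB f g : continuous_on f -> continuous_on g ->
  \int (fun t => f t - g t) = \int f - \int g.
Proof. by move=> cf cg; rewrite RintegralB//; exact: within_itv_integrable. Qed.

Lemma itv_RintegralZ c f : continuous_on f ->
  \int (fun t => c * f t) = c * \int f.
Proof. by move=> cf; rewrite RintegralZl//; exact: within_itv_integrable. Qed.

Lemma itv_Rintegral_cst c : a <= b -> \int (fun=> c) = c * (b - a).
Proof.
move=> ab; rewrite Rintegral_cst//= lebesgue_measure_itv/= lte_fin.
have [//|ba] := ltP a b.
by have -> : b = a; [apply/eqP; rewrite eq_le ba|rewrite subrr].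
Qed.

Lemma itv_Rintegral_sum (I : Type) (r : seq I) (F : I -> R -> R) :
  (forall i, continuous_on (F i)) ->
  \int (fun t => \sum_(i <- r) F i t) = \sum_(i <- r) \int (F i).
Proof.
move=> cF; elim: r => [|i r IH].
  rewrite big_nil -[RHS](mul0r (\int (fun=> 0))).
  rewrite -itv_RintegralZ; last exact: within_continuous_cst.
  by apply: eq_Rintegral => t _; rewrite big_nil mul0r.
rewrite big_cons -IH -itv_RintegralD//; last exact: within_continuous_sum.
by apply: eq_Rintegral => t _; rewrite big_cons.
Qed.

Lemma le_itv_Rintegral f g : continuous_on f -> continuous_on g ->
  (forall t, t \in `[a, b] -> f t <= g t) -> \int f <= \int g.
Proof.
by move=> cf cg fg; apply: le_Rintegral => //; exact: within_itv_integrable.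
Qed.

(** If [f t] were positive, continuity would keep [f] above [f t / 2] on a segment [[c, d]] around
    [t]. The integral over [[c, d]] would then be positive, and so would the one over [[a, b]], as
    [f] is nonnegative. *)
Lemma itv_Rintegral_eq0 f : a < b -> continuous_on f ->
  (forall t, t \in `[a, b] -> 0 <= f t) -> \int f = 0 ->
  forall t, t \in `]a, b[ -> f t = 0.
Proof.
move=> ab cf f0 If t tab; apply/eqP; rewrite eq_le.
apply/andP; split; last first.
  by apply: f0; exact: subset_itv_oo_cc tab.
rewrite leNgt; apply/negP => ft0.
have /cvgrPdist_lt /(_ (f t / 2)) := within_continuous_continuous ab cf tab.
rewrite divr_gt0// => /(_ isT) nft.
have : \forall u \near t, (u \in `]a, b[) /\ `|f t - f u| < f t / 2.
  by apply: filterI => //; exact: near_in_itvoo.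
move=> /nbhs_ballP[e /= e0 be].
pose c := t - e / 2; pose d := t + e / 2.
have cd : c < d by rewrite /c /d; lra.
have h u : u \in `[c, d] -> (u \in `]a, b[) /\ f t / 2 <= f u.
  rewrite in_itv/= => ucd; have [|uab] := be u.
    rewrite /ball/= ltr_norml; move: ucd; rewrite /c /d; lra.
  by rewrite ltr_norml => ?; split => //; lra.
have sub : `[c, d] `<=` `[a, b].
  by move=> u /h[uab _]; exact: subset_itv_oo_cc uab.
have cf' : {within `[c, d], continuous f} := continuous_subspaceW sub cf.
have : 0 < \int[mu]_(u in `[c, d]) (f t / 2).
  rewrite Rintegral_cst//= lebesgue_measure_itv/= lte_fin cd -EFinD /=.
  by rewrite mulr_gt0 ?subr_gt0// divr_gt0.
apply/negP; rewrite -leNgt -If.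
apply: (@le_trans _ _ (\int[mu]_(u in `[c, d]) f u)).
  apply: le_Rintegral => //.
  - by apply: continuous_compact_integrable; [exact: segment_compact|
      exact: within_continuous_cst].
  - by apply: continuous_compact_integrable => //; exact: segment_compact.
  - by move=> u /h[].
have icd : mu.-integrable `[c, d] (EFin \o f).
  by apply: continuous_compact_integrable => //; exact: segment_compact.
rewrite /Rintegral fine_le//.
- exact: integrable_fin_num.
- by apply: integrable_fin_num => //; exact: within_itv_integrable.
apply: ge0_subset_integral => //.
- by case/integrableP: (within_itv_integrable cf).
Qed.

End IntegralsOfContinuousFunctions.

(** * Cosine moments, Toeplitz positivity and Fejer means *)

Section CosineMoments.
Variable R : realType.
Implicit Types (f g h : R -> R) (x t : R) (d : nat).
Local Notation continuous_on f := {within `[0, pi], continuous f}.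
Local Notation "'\int' f" :=
  (\int[lebesgue_measure]_(t in `[0, pi]) f t) (at level 36).

(** So the Toeplitz matrix of the [cos (k x)] is a sum of two rank-one matrices, built on the
    vectors [cos (i x)] and [sin (i x)]. Both links between Toeplitz positivity and nonnegative
    functions rest on this. *)
Lemma cos_distn x (i j : nat) : cos (x *+ `|i - j|%N) =
  cos (x *+ i) * cos (x *+ j) + sin (x *+ i) * sin (x *+ j).
Proof.
wlog ij : i j / (i <= j)%N => [h|].
  have [/h //|/ltnW/h] := leqP i j.
  by rewrite distnC => ->; rewrite mulrC [X in _ + X]mulrC.
by rewrite distnEr// mulrnBr// cosB mulrC [X in _ + X]mulrC.
Qed.

Lemma continuous_cosMn (n : nat) : continuous (fun t : R => cos (t *+ n)).
Proof.
move=> t; apply: (@continuous_comp _ _ _ (fun u : R => u *+ n) cos).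
  exact: natmul_continuous.
exact: continuous_cos.
Qed.

Lemma continuous_sinMn (n : nat) : continuous (fun t : R => sin (t *+ n)).
Proof.
move=> t; apply: (@continuous_comp _ _ _ (fun u : R => u *+ n) sin).
  exact: natmul_continuous.
exact: continuous_sin.
Qed.

Lemma sinMn_pi (n : nat) : sin (pi *+ n : R) = 0.
Proof.
by elim: n => [|n IH]; rewrite ?mulr0n ?sin0// mulrSr sinD sinpi IH; ring.
Qed.

Lemma Rintegral_cosMn (n : nat) :
  \int (fun t => cos (t *+ n)) = if n == 0%N then pi else 0.
Proof.
case: n => [|n] /=.
  transitivity (\int (fun=> 1 : R)).
    by apply: eq_Rintegral => t _; rewrite mulr0n cos0.
  by rewrite itv_Rintegral_cst ?pi_ge0// subr0 mul1r.
have n0 : n.+1%:R != 0 :> R by rewrite pnatr_eq0.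
pose F (t : R) : R := n.+1%:R^-1 * sin (t *+ n.+1).
have cF : continuous F.
  move=> t; apply: (@continuousM _ _ (fun=> _)); first exact: cvg_cst.
  exact: continuous_sinMn.
have dF (t : R) : is_derive t 1 F (cos (t *+ n.+1)).
  have -> : F = n.+1%:R^-1 \*: (sin \o ( *%R n.+1%:R)).
    by apply/funext => u; rewrite /F /= mulr_natl.
  have dM : is_derive t 1 ( *%R (n.+1%:R : R)) n.+1%:R.
    by apply: is_derive_eq; rewrite /GRing.scale /= mulr1.
  have dS := is_derive1_comp (is_derive_sin _) dM.
  apply: (is_derive_eq (is_deriveZ _ dS)).
  by rewrite /GRing.scale /= mulr_natl mulrC mulfK.
rewrite /Rintegral (@continuous_FTC2 _ _ F).
- by rewrite /F sinMn_pi mul0rn sin0 mulr0 -EFinB subrr.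
- exact: pi_gt0.
- by apply: continuous_subspaceT; exact: continuous_cosMn.
- split; first by move=> t _; case: (dF t).
  + by apply: cvg_at_right_filter; exact: cF.
  + by apply: cvg_at_left_filter; exact: cF.
- by move=> t _; rewrite derive1E derive_val.
Qed.

Definition cos_moments d g : 'cV[R]_d.+1 :=
  \col_(k < d.+1) \int (fun t => cos (t *+ k) * g t).

(** Grouping by [k = |i - j|] gives the Cesaro mean of the cosine series [y_0 / pi + (2 / pi) *
    sum_k y_k cos (k x)], with weights [1 - k / (d + 1)]. The ungrouped sum is kept because it
    matches the quadratic form of [Toep y]. *)
Definition fejer d (y : 'cV[R]_d.+1) x : R := (pi *+ d.+1)^-1 *
  \sum_(j < d.+1) \sum_(i < d.+1)
    y (inord `|i - j|%N) 0 * cos (x *+ `|i - j|%N).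

Lemma inord_distn d (i j : 'I_d.+1) :
  (inord `|i - j|%N : 'I_d.+1) = `|i - j|%N :> nat.
Proof.
by apply: (@inordK d); have := ltn_ord i; have := ltn_ord j; lia.
Qed.

(** The quadratic form at [v] is the integral of [g * (C ^+ 2 + D ^+ 2)], where [C] and [D] are the
    sums of the [v i * cos (i t)] and of the [v i * sin (i t)]. *)
Lemma psd_Toep_cos_moments d g : continuous_on g ->
  (forall t, t \in `[0, pi] -> 0 <= g t) -> psd (Toep (cos_moments d g)).
Proof.
move=> cg g0; split=> [|v]; first exact: tr_Toep.
rewrite Toep_quadE.
have cG (k : nat) : continuous_on (fun t => cos (t *+ k) * g t).
  apply: within_continuousM => //.
  by apply: continuous_subspaceT; exact: continuous_cosMn.
have cF (k : nat) (c : R) : continuous_on (fun t => c * (cos (t *+ k) * g t)).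
  by apply: within_continuousM => //; exact: within_continuous_cst.
under eq_bigr => j _.
  under eq_bigr => i _.
    rewrite mxE inord_distn mulrAC -itv_RintegralZ//.
  over.
  rewrite -itv_Rintegral_sum//.
over.
rewrite -itv_Rintegral_sum//; last by move=> j; exact: within_continuous_sum.
apply: Rintegral_ge0 => t; rewrite /= => tpi.
pose C := \sum_i v i 0 * cos (t *+ i); pose D := \sum_i v i 0 * sin (t *+ i).
rewrite (_ : \sum_j _ = g t * (C * C + D * D)); last first.
  rewrite /C /D !big_distrlr /= -big_split mulr_sumr /=; apply: eq_bigr => j _.
  rewrite -big_split mulr_sumr /=; apply: eq_bigr => i _.
  by rewrite cos_distn; ring.
by rewrite mulr_ge0 ?g0// addr_ge0// -expr2 sqr_ge0.
Qed.

(** The values of the quadratic form at the vectors [cos (i x)] and [sin (i x)] add up to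
    [pi * (d + 1)] times the Fejer mean. *)
Lemma fejer_ge0 d (y : 'cV[R]_d.+1) x : psd (Toep y) -> 0 <= fejer y x.
Proof.
move=> [_ y0]; apply: mulr_ge0; first by rewrite invr_ge0 mulrn_wge0// pi_ge0.
have := addr_ge0 (y0 (\col_i cos (x *+ i))) (y0 (\col_i sin (x *+ i))).
rewrite !Toep_quadE -big_split /= => /le_trans; apply.
rewrite le_eqVlt; apply/orP; left; apply/eqP.
apply: eq_bigr => j _; rewrite -big_split /=; apply: eq_bigr => i _.
by rewrite !mxE cos_distn; ring.
Qed.

Lemma fejerB d (y z : 'cV[R]_d.+1) x :
  fejer (y - z) x = fejer y x - fejer z x.
Proof.
rewrite /fejer -mulrBr -sumrB; congr (_ * _); apply: eq_bigr => j _.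
by rewrite -sumrB; apply: eq_bigr => i _; rewrite !mxE mulrBl.
Qed.

Lemma fejerD d (y z : 'cV[R]_d.+1) x :
  fejer (y + z) x = fejer y x + fejer z x.
Proof.
rewrite /fejer -mulrDr -big_split; congr (_ * _); apply: eq_bigr => j _.
by rewrite -big_split; apply: eq_bigr => i _; rewrite !mxE mulrDl.
Qed.

Lemma fejerZ d (y : 'cV[R]_d.+1) c x : fejer (c *: y) x = c * fejer y x.
Proof.
rewrite /fejer mulrCA; congr (_ * _); rewrite mulr_sumr; apply: eq_bigr => j _.
by rewrite mulr_sumr; apply: eq_bigr => i _; rewrite !mxE mulrA.
Qed.

Lemma continuous_fejer d (y : 'cV[R]_d.+1) : continuous (fejer y).
Proof.
move=> x; apply: (@continuousM _ _ (fun=> _)); first exact: cvg_cst.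
move: x; apply: sum_continuous => j; apply: sum_continuous => i x.
apply: (@continuousM _ _ (fun=> _)); first exact: cvg_cst.
exact: continuous_cosMn.
Qed.

(** Off the diagonal the cosines integrate to zero; each of the [d + 1] diagonal terms gives
    [pi * y 0 0]. *)
Lemma Rintegral_fejer d (y : 'cV[R]_d.+1) : \int (fejer y) = y 0 0.
Proof.
have c1 (i j : 'I_d.+1) : continuous_on
    (fun t => y (inord `|i - j|%N) 0 * cos (t *+ `|i - j|%N)).
  apply: within_continuousM; first exact: within_continuous_cst.
  by apply: continuous_subspaceT; exact: continuous_cosMn.
have c2 (j : 'I_d.+1) : continuous_on (fun t =>
    \sum_(i < d.+1) y (inord `|i - j|%N) 0 * cos (t *+ `|i - j|%N)).
  exact: within_continuous_sum.
rewrite /fejer itv_RintegralZ; last exact: within_continuous_sum.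
rewrite itv_Rintegral_sum//.
under eq_bigr => j _.
  rewrite itv_Rintegral_sum//.
  rewrite (bigD1 j)//= big1 => [|i ij]; last first.
    rewrite itv_RintegralZ; last first.
      by apply: continuous_subspaceT; exact: continuous_cosMn.
    rewrite Rintegral_cosMn ifN ?mulr0//.
    by move: ij; rewrite -val_eqE /=; lia.
  rewrite itv_RintegralZ; last first.
    by apply: continuous_subspaceT; exact: continuous_cosMn.
  rewrite Rintegral_cosMn distnn eqxx addr0.
over.
rewrite sumr_const card_ord.
have -> : inord 0 = 0 :> 'I_d.+1 by apply/val_inj; rewrite /= inordK.
rewrite -mulrnAr mulrCA mulVf ?mulr1// mulrn_eq0 /=.
by rewrite gt_eqF// pi_gt0.
Qed.

End CosineMoments.

(** Close points cost at most [e]; for distant ones the square absorbs the bound on [|h|]. Near each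
    [c] every large enough [A] works, and compactness makes this uniform in [c]. *)
Lemma quadratic_modulus (R : realType) (h : R -> R) (a b e : R) :
  {within `[a, b], continuous h} -> 0 < e ->
  exists2 A : R, 0 <= A & forall x y, x \in `[a, b] -> y \in `[a, b] ->
    `|h x - h y| <= e + A * (x - y) ^+ 2.
Proof.
move=> ch e0.
have [M M0 hM] : exists2 M : R, 0 <= M & forall x, x \in `[a, b] -> `|h x| <= M.
  have /compact_bounded[M [_ hM]] :=
    continuous_compact ch (@segment_compact _ a b).
  exists (`|M| + 1); first by rewrite addr_ge0.
  move=> x xab; apply: (hM (`|M| + 1)); last by exists x.
  by rewrite (le_lt_trans (ler_norm M))// ltrDl.
have /compact_near_coveringP/near_covering_withinP := @segment_compact _ a b.
pose P (A x : R) := forall y : R, y \in `[a, b] ->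
  `|h x - h y| <= e + A * (x - y) ^+ 2.
move=> /(_ _ (pinfty_nbhs R) P) /=.
case=> [c cab|A0 [_ hA]]; last first.
  exists (`|A0| + 1); first by rewrite addr_ge0.
  move=> x y xab yab; apply: (hA (`|A0| + 1)) => //.
  by rewrite (le_lt_trans (ler_norm A0))// ltrDl.
have /cvgrPdist_lt /(_ (e / 2)) := (subspace_continuousP _ _).1 ch c cab.
rewrite divr_gt0// => /(_ isT); rewrite near_withinE => /nbhs_ballP[r /= r0 hr].
have r20 : 0 < (r / 2) ^+ 2 by rewrite exprn_gt0// divr_gt0.
(* Then [A0 * (r / 2) ^+ 2 = 2 * M], which bounds every [|h x - h y|]. *)
pose A0 := 2 * M / (r / 2) ^+ 2.
exists (ball c (r / 2), [set A | A0 <= A]).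
  split; first by apply: nbhsx_ballx; exact: divr_gt0.
  by apply: nbhs_pinfty_ge; exact: num_real.
move=> [x A] /= [cx A0A] xab y yab.
have A00 : 0 <= A by rewrite (le_trans _ A0A)// divr_ge0 ?mulr_ge0// ltW.
have hx : `|h c - h x| < e / 2.
  apply: hr => //; move: cx; rewrite /ball/= => /lt_trans; apply.
  by rewrite ltr_pdivrMr// ltr_pMr// ltr1n.
(* Either [h x] and [h y] are both within [e / 2] of [h c], or [|x - y| >= r / 2] and the quadratic
   term suffices. *)
have [yc|yc] := ltP `|c - y| r.
  have hy : `|h c - h y| < e / 2 by exact: hr.
  have := ler_distD (h c) (h x) (h y); rewrite [`|h x - h c|]distrC.
  by have := mulr_ge0 A00 (sqr_ge0 (x - y)); lra.
have xy : r / 2 <= `|x - y|.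
  by have := ler_distD x c y; move: cx; rewrite /ball/=; lra.
have : (r / 2) ^+ 2 <= (x - y) ^+ 2.
  by rewrite -[leRHS]real_normK ?num_real// lerXn2r// nnegrE ltW// divr_gt0.
move=> /(ler_wpM2l A00); have := ler_wpM2r (ltW r20) A0A.
rewrite /A0 mulfVK ?gt_eqF//.
have := ler_normB (h x) (h y); have := hM _ xab; have := hM _ yab.
by move: e0; lra.
Qed.

(** * Uniform convergence of Fejer means by a Korovkin argument *)

Section FejerKorovkin.
Variable R : realType.
Implicit Types (f g h : R -> R) (x t c : R) (d : nat).
Local Notation continuous_on f := {within `[0, pi], continuous f}.
Local Notation "'\int' f" :=
  (\int[lebesgue_measure]_(t in `[0, pi]) f t) (at level 36).

(** Only the main diagonal and the two nearest ones on each side contribute; their lengths are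
    [n + 2], [n + 1] and [n]. *)
Lemma sum_toeplitz_band (f : nat -> R) n : (forall k, f k.+3 = 0) ->
  \sum_(j < n.+2) \sum_(i < n.+2) f `|i - j|%N =
  n.+2%:R * f 0 + 2 * n.+1%:R * f 1 + 2 * n%:R * f 2.
Proof.
move=> f0; elim: n => [|n IH].
  rewrite !big_ord_recl !big_ord0.
  by change (f 0%N + (f 1%N + 0) + (f 1%N + (f 0%N + 0) + 0) =
    2 * f 0%N + 2 * 1 * f 1%N + 2 * 0 * f 2); ring.
rewrite big_ord_recr /=.
under eq_bigr => j _.
  rewrite big_ord_recr /=.
over.
rewrite big_split /= IH [X in _ + _ + X]big_ord_recr /= distnn.
(* Apart from the corner, the new last row and the new last column each add [f 1 + f 2]. *)
have E (F : nat -> nat) : (forall i, i < n.+2 -> F i = n.+2 - i)%N ->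
    \sum_(i < n.+2) f (F i) = f 1%N + f 2%N.
  move=> FE; rewrite 2!big_ord_recr /= big1 ?add0r => [|i _].
    rewrite !FE//; have -> : (n.+2 - n = 2)%N by lia.
    by rewrite subSnn addrC.
  rewrite FE; last by rewrite ltnS ltnW// ltnS ltnW.
  rewrite (_ : (n.+2 - i = (n - i.+1).+3)%N) ?f0//.
  by have := ltn_ord i; lia.
rewrite (E (fun i => `|n.+2 - i|%N)); last by move=> i; lia.
rewrite (E (fun i => `|i - n.+2|%N)); last by move=> i; lia.
ring.
Qed.

Lemma fejer_band d (y : 'cV[R]_d.+2) (c : nat -> R) x :
  (forall k, y k 0 = c k) -> (forall k, c k.+3 = 0) ->
  fejer y x = (pi *+ d.+2)^-1 *
    (d.+2%:R * c 0 + 2 * d.+1%:R * (c 1 * cos x) +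
     2 * d%:R * (c 2 * cos (x *+ 2))).
Proof.
move=> yc c0; rewrite /fejer; congr (_ * _).
under eq_bigr => j _ do under eq_bigr => i _ do rewrite yc inord_distn.
rewrite (sum_toeplitz_band (f := fun k => c k * cos (x *+ k))) => [|k].
  by rewrite mulr0n cos0 mulr1 mulr1n.
by rewrite c0 mul0r.
Qed.

Lemma cosMnD_distn x (i j : nat) :
  cos (x *+ (i + j)) + cos (x *+ `|i - j|%N) = 2 * cos (x *+ i) * cos (x *+ j).
Proof. by rewrite cos_distn mulrnDr cosD; ring. Qed.

Let J (n : nat) : R := if n == 0%N then pi else 0.

(** Expand the square as [(1/2 + c^2) - 2 c cos t + (1/2) cos (2 t)] and multiply by [cos (k t)]
    with [cosMnD_distn]; [J] holds the integrals of the resulting cosines. All terms vanish for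
    [k >= 3]. *)
Lemma cos_moments_quadratic d c (k : 'I_d.+1) :
  cos_moments d (fun t => (cos t - c) ^+ 2) k 0 =
  (2^-1 + c ^+ 2) * J k + (- c) * (J k.+1 + J `|k - 1|%N) +
  4^-1 * (J k.+2 + J `|k - 2|%N).
Proof.
rewrite mxE.
have cc n : continuous_on (fun t => cos (t *+ n)).
  by apply: continuous_subspaceT; exact: continuous_cosMn.
have cD f g : continuous_on f -> continuous_on g ->
    continuous_on (fun t => f t + g t) by exact: within_continuousD.
have cZ b f : continuous_on f -> continuous_on (fun t => b * f t).
  by apply: within_continuousM; exact: within_continuous_cst.
have -> : (fun t => cos (t *+ k) * (cos t - c) ^+ 2) = (fun t =>
    (2^-1 + c ^+ 2) * cos (t *+ k) +
    (- c) * (cos (t *+ (k + 1)) + cos (t *+ `|k - 1|%N)) +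
    4^-1 * (cos (t *+ (k + 2)) + cos (t *+ `|k - 2|%N))).
  apply/funext => t; rewrite !cosMnD_distn mulr1n cos_mulr2n.
  by move: (cos t) (cos (t *+ k)) => C X; field.
rewrite !itv_RintegralD ?itv_RintegralZ ?itv_RintegralD ?Rintegral_cosMn;
  do ?by [|apply: cD|apply: cZ|auto 6].
  by rewrite addn1 addn2.
Qed.

(** Taking the Fejer mean multiplies [cos t] by [1 - 1/(d+1)] and [cos (2 t)] by [1 - 2/(d+1)]; at
    the point [x] itself all terms in [cos x] cancel. *)
Lemma fejer_quadratic d x : (0 < d)%N ->
  fejer (cos_moments d (fun t => (cos t - cos x) ^+ 2)) x = d.+1%:R^-1.
Proof.
case: d => // d _.
rewrite (fejer_band (c := fun k => (2^-1 + cos x ^+ 2) * J k +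
  (- cos x) * (J k.+1 + J `|k - 1|%N) + 4^-1 * (J k.+2 + J `|k - 2|%N))).
- rewrite /J /= cos_mulr2n -[pi *+ _]mulr_natr.
  have p0 : (pi : R) != 0 by rewrite gt_eqF// pi_gt0.
  have : d.+2%:R != 0 :> R by rewrite pnatr_eq0.
  have -> : d.+1%:R = d%:R + 1 :> R by rewrite -natr1.
  have -> : d.+2%:R = d%:R + 2 :> R by rewrite -addn2 natrD.
  by move: (d%:R) (pi) (cos x) p0 => D p C p0 D0; field; rewrite D0 p0.
- by move=> k; exact: cos_moments_quadratic.
- by move=> k; rewrite /J /=; ring.
Qed.

Lemma fejer_cst d x : (0 < d)%N -> fejer (cos_moments d (fun=> 1)) x = 1.
Proof.
case: d => // d _; rewrite (fejer_band (c := J)).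
- rewrite /J /= !mul0r !mulr0 !addr0 mulr_natl mulVf//.
  by rewrite mulrn_eq0 /= gt_eqF// pi_gt0.
- move=> k; rewrite mxE /J -Rintegral_cosMn.
  by apply: eq_Rintegral => t _; rewrite mulr1.
- by [].
Qed.

Lemma cos_momentsB d f g : continuous_on f -> continuous_on g ->
  cos_moments d (fun t => f t - g t) = cos_moments d f - cos_moments d g.
Proof.
move=> cf cg; apply/matrixP => k j; rewrite !mxE -itv_RintegralB.
- by apply: eq_Rintegral => t _; rewrite mulrBr.
- apply: within_continuousM => //.
  by apply: continuous_subspaceT; exact: continuous_cosMn.
- apply: within_continuousM => //.
  by apply: continuous_subspaceT; exact: continuous_cosMn.
Qed.

Lemma cos_momentsZ d c f : continuous_on f ->
  cos_moments d (fun t => c * f t) = c *: cos_moments d f.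
Proof.
move=> cf; apply/matrixP => k j; rewrite !mxE -itv_RintegralZ.
- by apply: eq_Rintegral => t _; rewrite mulrCA.
- apply: within_continuousM => //.
  by apply: continuous_subspaceT; exact: continuous_cosMn.
Qed.

Lemma le_fejer_cos_moments d f g x : continuous_on f -> continuous_on g ->
  (forall t, t \in `[0, pi] -> f t <= g t) ->
  fejer (cos_moments d f) x <= fejer (cos_moments d g) x.
Proof.
move=> cf cg fg; rewrite -subr_ge0 -fejerB -cos_momentsB//.
apply: fejer_ge0; apply: psd_Toep_cos_moments; first exact: within_continuousB.
by move=> t /fg; rewrite subr_ge0.
Qed.

Lemma within_continuous_comp_cos h : {within `[-1, 1], continuous h} ->
  continuous_on (fun t => h (cos t)).
Proof.
apply: within_continuous_comp2 => [t _|].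
  by rewrite /= in_itv /= cos_geN1 cos_le1.
by apply: continuous_subspaceT; exact: continuous_cos.
Qed.

(** The Fejer mean is monotone and fixes constants. Applied in [t] to [|h (cos t) - h (cos x)| <= e
    / 2 + A * (cos t - cos x) ^+ 2], it bounds the error at [x] by [e / 2 + A / (d + 1)], uniformly
    in [x]. *)
Lemma fejer_cvg h e : {within `[-1, 1], continuous h} -> 0 < e ->
  exists D, forall d, (D <= d)%N -> forall x, x \in `[0, pi] ->
    `|h (cos x) - fejer (cos_moments d (fun t => h (cos t))) x| <= e.
Proof.
move=> ch e0; have e20 : 0 < e / 2 by rewrite divr_gt0.
have [A A0 hA] := quadratic_modulus ch e20.
(* This makes [A / (d + 1) <= e / 2]. *)
exists (Num.truncn (2 * A / e)).+1 => d Dd x _.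
have d0 : (0 < d)%N by apply: leq_trans Dd.
have cosI t : cos t \in `[-1, 1] by rewrite in_itv /= cos_geN1 cos_le1.
have cq : continuous_on (fun t => (cos t - cos x) ^+ 2).
  apply: continuous_subspaceT => t.
  apply: (@continuousM _ _ (fun t => cos t - cos x) (fun t => cos t - cos x));
    by apply: cvgB; [exact: continuous_cos|exact: cvg_cst].
have cc c : continuous_on (fun _ : R => c : R) by exact: within_continuous_cst.
have cZ b f : continuous_on f -> continuous_on (fun t => b * f t).
  by move=> cf; exact: within_continuousM.
have chc := within_continuous_comp_cos ch.
(* The factor [1] and the sign [- (- A)] give [u] and [v] the shape that [cos_momentsB] and
   [cos_momentsZ] expect. *)
pose u t := h (cos t) - h (cos x) * 1.
pose v t := e / 2 * 1 - (- A) * (cos t - cos x) ^+ 2.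
have cu : continuous_on u by apply: within_continuousB => //; exact: cZ.
have cv : continuous_on v by apply: within_continuousB => //; exact: cZ.
(* At [x] the Fejer mean of [v] is [e / 2 + A / (d + 1)]. *)
have uv t : `|u t| <= v t.
  by rewrite /u /v !mulr1 mulNr opprK; exact: hA.
have Fu : fejer (cos_moments d u) x =
    fejer (cos_moments d (fun t => h (cos t))) x - h (cos x).
  rewrite cos_momentsB ?cos_momentsZ//; do ?exact: cZ.
  by rewrite fejerB fejerZ fejer_cst// mulr1.
have Fv : fejer (cos_moments d v) x = e / 2 + A / d.+1%:R.
  rewrite cos_momentsB ?cos_momentsZ//; do ?exact: cZ.
  by rewrite fejerB !fejerZ fejer_cst// fejer_quadratic// mulr1 mulNr opprK.
have vb : e / 2 + A / d.+1%:R <= e.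
  rewrite [leRHS]splitr lerD2l ler_pdivrMr ?ltr0n// mulrAC ler_pdivlMr//.
  rewrite [A * 2]mulrC [e * _]mulrC -ler_pdivrMr//.
  apply: (le_trans (ltW (truncnS_gt _))).
  by rewrite ler_nat (leq_trans Dd).
rewrite distrC -Fu ler_norml; apply/andP; split.
  rewrite lerNl -mulN1r -fejerZ -cos_momentsZ//.
  apply: le_trans vb; rewrite -Fv; apply: le_fejer_cos_moments => //.
    exact: cZ.
  by move=> t _; rewrite mulN1r (le_trans _ (uv t))// -normrN ler_norm.
apply: le_trans vb; rewrite -Fv; apply: le_fejer_cos_moments => //.
by move=> t _; rewrite (le_trans _ (uv t))// ler_norm.
Qed.

End FejerKorovkin.

(** * Positive semidefinite decompositions of moments and the integral of [|g|] *)

Section MomentsOfDensities.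
Variable R : realType.
Implicit Types (f g h : R -> R) (x t c e : R) (d : nat).
Local Notation continuous_on f := {within `[0, pi], continuous f}.
Local Notation "'\int' f" :=
  (\int[lebesgue_measure]_(t in `[0, pi]) f t) (at level 36).

Lemma within_continuous_cosM n f : continuous_on f ->
  continuous_on (fun t => cos (t *+ n) * f t).
Proof.
apply: within_continuousM; apply: continuous_subspaceT.
exact: continuous_cosMn.
Qed.

Lemma cos_moments_sum d (I : Type) (r : seq I) (c : I -> R) (F : I -> R -> R) :
  (forall i, continuous_on (F i)) ->
  cos_moments d (fun t => \sum_(i <- r) c i * F i t) =
  \sum_(i <- r) c i *: cos_moments d (F i).
Proof.
move=> cF; apply/matrixP => k j; rewrite summxE mxE.
have cG i : continuous_on (fun t => c i * (cos (t *+ k) * F i t)).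
  apply: within_continuousM; first exact: within_continuous_cst.
  exact: within_continuous_cosM.
transitivity (\int (fun t => \sum_(i <- r) c i * (cos (t *+ k) * F i t))).
  by apply: eq_Rintegral => t _; rewrite mulr_sumr; apply: eq_bigr => i _; ring.
rewrite itv_Rintegral_sum//; apply: eq_bigr => i _.
by rewrite !mxE itv_RintegralZ//; exact: within_continuous_cosM.
Qed.

Lemma fejer_sum d (I : Type) (r : seq I) (c : I -> R) (y : I -> 'cV[R]_d.+1) x :
  fejer (\sum_(i <- r) c i *: y i) x = \sum_(i <- r) c i * fejer (y i) x.
Proof.
elim: r => [|i r IH]; last by rewrite !big_cons fejerD fejerZ IH.
by rewrite !big_nil -(scale0r 0) fejerZ mul0r.
Qed.

(** Take the moments of the positive and negative parts [(|g| + g) / 2] and [(|g| - g) / 2]; their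
    moments of order zero add up to the integral of [|g|]. *)
Lemma cos_moments_psd_decomposition d g : continuous_on g ->
  exists yp ym : 'cV[R]_d.+1, [/\ yp - ym = cos_moments d g, psd (Toep yp),
    psd (Toep ym) & yp 0 0 + ym 0 0 = \int (fun t => `|g t|)].
Proof.
move=> cg; have cn := within_continuous_norm cg.
have cp : continuous_on (fun t => 2^-1 * (`|g t| + g t)).
  apply: within_continuousM; first exact: within_continuous_cst.
  exact: within_continuousD.
have cm : continuous_on (fun t => 2^-1 * (`|g t| - g t)).
  apply: within_continuousM; first exact: within_continuous_cst.
  exact: within_continuousB.
exists (cos_moments d (fun t => 2^-1 * (`|g t| + g t))).
exists (cos_moments d (fun t => 2^-1 * (`|g t| - g t))); split.
- by rewrite -cos_momentsB//; congr cos_moments; apply/funext => t; field.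
- apply: psd_Toep_cos_moments => // t _; rewrite mulr_ge0// -lerBlDr sub0r.
  by rewrite -normrN ler_norm.
- apply: psd_Toep_cos_moments => // t _.
  by rewrite mulr_ge0// subr_ge0 ler_norm.
- rewrite !mxE -itv_RintegralD; [|exact: within_continuous_cosM..].
  by apply: eq_Rintegral => t _; rewrite mulr0n cos0; field.
Qed.

(** The Fejer means of [yp] and [ym] are nonnegative and [g] is within [e] of their difference, so
    [|g|] is at most their sum plus [e]. Integrating over [[0, pi]] turns the means into [yp 0 0]
    and [ym 0 0]. *)
Lemma le_cos_moments_psd d g (yp ym : 'cV[R]_d.+1) e : continuous_on g ->
  yp - ym = cos_moments d g -> psd (Toep yp) -> psd (Toep ym) ->
  (forall x, x \in `[0, pi] -> `|g x - fejer (cos_moments d g) x| <= e) ->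
  \int (fun t => `|g t|) <= yp 0 0 + ym 0 0 + e * pi.
Proof.
move=> cg ypm pp pm ge; have cn := within_continuous_norm cg.
have cf (y : 'cV[R]_d.+1) : continuous_on (fejer y).
  by apply: continuous_subspaceT; exact: continuous_fejer.
have cc : continuous_on (fun _ : R => e) by exact: within_continuous_cst.
have Ie : e * pi = \int (fun=> e).
  by rewrite itv_Rintegral_cst ?pi_ge0// subr0.
rewrite -(Rintegral_fejer yp) -(Rintegral_fejer ym) Ie.
rewrite -!itv_RintegralD//; last first.
  exact: within_continuousD.
apply: le_itv_Rintegral => //.
  by apply: within_continuousD => //; exact: within_continuousD.
move=> t tI; have := ge _ tI; rewrite -ypm fejerB => /ler_normlP[h1 h2].
have := fejer_ge0 t pp; have := fejer_ge0 t pm.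
by move=> ? ?; apply/ler_normlP; split; lra.
Qed.

End MomentsOfDensities.

Lemma eventually_all (I : finType) (P : I -> nat -> Prop) :
  (forall i, exists D, forall d, (D <= d)%N -> P i d) ->
  exists D, forall d, (D <= d)%N -> forall i, P i d.
Proof.
move=> /choice[D hD]; exists (\max_i D i) => d Dd i.
by apply: hD; apply: leq_trans Dd; exact: leq_bigmax.
Qed.

(** * The density of one interval and the change of variable to [[0, pi]] *)

Section WeightedDensity.
Variables (R : realType) (a b : R) (w : R -> R).
Hypothesis ab : a < b.
Hypothesis w_pos : forall x, x \in `[a, b] -> 0 < w x.
Hypothesis w_cont : {within `[a, b], continuous w}.
Implicit Types (P : {poly R}).
Local Notation "'\int' f" :=
  (\int[lebesgue_measure]_(t in `[0, pi]) f t) (at level 36).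

(* [density P (cos theta)] is [g theta] on [[0, pi]]: the square root
   stands for [sin theta]. *)
Definition density P x : R :=
  P.[affine a b x] / w (affine a b x) * Num.sqrt (1 - x ^+ 2).

Lemma affine_itv x : x \in `[-1, 1] -> affine a b x \in `[a, b].
Proof. by rewrite !in_itv/= /affine; move: ab => ?; nra. Qed.

Lemma continuous_affine : continuous (affine a b).
Proof.
move=> x; rewrite /affine; apply: cvgMr_tmp; apply: cvgD; last exact: cvg_cst.
by apply: cvgD; [apply: cvgMl_tmp; exact: cvg_id|exact: cvg_cst].
Qed.

Lemma density_cos P t : t \in `[0, pi] ->
  density P (cos t) = P.[affine a b (cos t)] * sin t / w (affine a b (cos t)).
Proof.
rewrite in_itv/= => tI; rewrite /density -sin2cos2 sqrtr_sqr ger0_norm.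
  by rewrite mulrAC.
exact: sin_ge0_pi.
Qed.

Lemma within_continuous_invw :
  {within `[-1, 1], continuous (fun x => (w (affine a b x))^-1)}.
Proof.
apply: within_continuousV => [x /affine_itv/w_pos|].
  by move=> /gt_eqF ->.
apply: (@within_continuous_comp2 _ _ `[a, b]%classic) => //.
  by move=> x; exact: affine_itv.
by apply: continuous_subspaceT; exact: continuous_affine.
Qed.

Lemma within_continuous_density P : {within `[-1, 1], continuous (density P)}.
Proof.
apply: within_continuousM.
  apply: within_continuousM; last exact: within_continuous_invw.
  apply: continuous_subspaceT => x.
  apply: (@continuous_comp _ _ _ (affine a b)); first exact: continuous_affine.
  exact: continuous_horner.
apply: continuous_subspaceT => x.
apply: (@continuous_comp _ _ _ (fun x : R => 1 - x ^+ 2) Num.sqrt).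
  by apply: cvgB; [exact: cvg_cst|exact: exprn_continuous].
exact: sqrt_continuous.
Qed.

Lemma density_sum N P x : (size P <= N.+1)%N ->
  density P x = \sum_(i < N.+1) P`_i * density 'X^i x.
Proof.
move=> sP; rewrite /density (horner_coef_wide _ sP) !mulr_suml.
by apply: eq_bigr => i _; rewrite hornerXn; ring.
Qed.

(** [chebW] gives the coefficients of the pulled-back polynomial on the [chebU n], and
    [U_n (cos t) * sin t = sin ((n + 1) t)]. Summing the columns of the integral matrix against them
    therefore rebuilds [P * sin / w] under the integral. *)
Lemma cos_moments_density N d P : (size P <= N.+1)%N ->
  \matrix_(k < d.+1, n < N.+1) \int (fun t =>
    cos (t *+ k) * sin (t *+ n.+1) / w (affine a b (cos t)))
    *m chebW a b N *m polycoord N (@chebT R) P =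
  cos_moments d (fun t => density P (cos t)).
Proof.
move=> sP; rewrite -mulmxA; apply/matrixP => k j; rewrite ord1 {j} !mxE.
set q := _ *m _.
have qE t : \sum_(n < N.+1) q n 0 * sin (t *+ n.+1) =
    P.[affine a b (cos t)] * sin t.
  rewrite -[in RHS](polycoordK (@size_chebT R) sP) -horner_poly_pullback chebWP.
  rewrite horner_sum mulr_suml; apply: eq_bigr => n _.
  by rewrite hornerZ -mulrA horner_chebU.
have cI (n : nat) : {within `[0, pi], continuous (fun t =>
    cos (t *+ k) * sin (t *+ n.+1) / w (affine a b (cos t)))}.
  apply: within_continuousM; last first.
    exact: (within_continuous_comp_cos within_continuous_invw).
  apply: within_continuous_cosM; apply: continuous_subspaceT.
  exact: continuous_sinMn.
transitivity (\sum_(n < N.+1) \int (fun t => q n 0 *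
    (cos (t *+ k) * sin (t *+ n.+1) / w (affine a b (cos t))))).
  by apply: eq_bigr => n _; rewrite mxE mulrC itv_RintegralZ.
rewrite -itv_Rintegral_sum; last first.
  by move=> n; apply: within_continuousM => //; exact: within_continuous_cst.
apply: eq_Rintegral => t; rewrite inE /= => tI; rewrite density_cos// -qE.
rewrite mulr_suml mulr_sumr; apply: eq_bigr => n _.
ring.
Qed.

(** Substitute [affine a b (cos t)], which decreases from [b] to [a] on [[0, pi]]; its derivative
    [- ((b - a) / 2 * sin t)] supplies the sine of the density. *)
Lemma Rintegral_density P :
  (b - a) / 2 * \int (fun t => `|density P (cos t)|) =
  \int[lebesgue_measure]_(t in `[a, b]) (`|P.[t]| / w t).
Proof.
pose F t := affine a b (cos t).
have F0 : F 0 = b by rewrite /F /affine cos0; lra.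
have Fpi : F pi = a by rewrite /F /affine cospi; lra.
have cF : continuous F.
  move=> t; apply: (@continuous_comp _ _ _ cos); first exact: continuous_cos.
  exact: continuous_affine.
have dF (t : R) : is_derive t 1 F (- ((b - a) / 2 * sin t)).
  have -> : F = (b - a) / 2 \*: cos + cst ((a + b) / 2).
    apply/funext => u; rewrite /F /affine fctE /cst /= -[_ *: _]/(_ * _).
    by field.
  by apply: is_derive_eq; rewrite addr0 -[_ *: _]/(_ * _) mulrN.
have F'E : (derive1 F) = fun t => - ((b - a) / 2 * sin t).
  by apply/funext => t; rewrite derive1E derive_val.
have cF' : continuous (derive1 F).
  rewrite F'E => t; apply: cvgN; apply: cvgMl_tmp; exact: continuous_sin.
have cG : {within `[F pi, F 0], continuous (fun t => `|P.[t]| / w t)}.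
  rewrite F0 Fpi; apply: within_continuousM.
    apply: within_continuous_norm; apply: continuous_subspaceT.
    exact: continuous_horner.
  by apply: within_continuousV => // x /w_pos/gt_eqF ->.
transitivity (fine (\int[lebesgue_measure]_(t in `[F pi, F 0%R])
  (`|P.[t]| / w t)%:E)); last by rewrite F0 Fpi.
rewrite (integration_by_substitution_decreasing (pi_ge0 R))//; first last.
- split; first by move=> t _; case: (dF t).
  + by apply: cvg_at_right_filter; exact: cF.
  + by apply: cvg_at_left_filter; exact: cF.
- apply/cvg_ex; exists (derive1 F pi).
  by apply: cvg_at_left_filter; exact: cF'.
- apply/cvg_ex; exists (derive1 F 0).
  by apply: cvg_at_right_filter; exact: cF'.
- move=> x y xI yI xy; rewrite /F /affine.
  have : cos x < cos y by rewrite ltr_cos.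
  by move: ab => ?; nra.
rewrite -itv_RintegralZ; last first.
  apply: within_continuous_norm.
  by apply: within_continuous_comp_cos; exact: within_continuous_density.
congr fine; apply: eq_integral => t; rewrite inE /= => tI.
rewrite density_cos// normrM normrM normfV.
rewrite (@ger0_norm _ (sin t)); last first.
  by apply: sin_ge0_pi; move: tI; rewrite in_itv.
rewrite (@gtr0_norm _ (w _)); last first.
  by apply: w_pos; apply: affine_itv; rewrite in_itv /= cos_geN1 cos_le1.
congr EFin; rewrite fctE /= -/(F t) F'E. rewrite opprK; ring.
Qed.

End WeightedDensity.

(** The reference norm on degree at most [N], in which approximation errors are measured and
    subsequences converge. *)
Definition coef_norm (R : realType) N (P : {poly R}) : R :=
  \sum_(i < N.+1) `|P`_i|.

Lemma coef_norm_ge0 (R : realType) N (P : {poly R}) : 0 <= coef_norm N P.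
Proof. exact: sumr_ge0. Qed.

(** * Comparison of the ersatz norm with [L1norm] from both sides *)

Section ErsatzBounds.
Variables (R : realType) (L : nat) (a b : 'I_L.+1 -> R) (w : R -> R).
Hypothesis ab : forall l, a l < b l.
Hypothesis w_pos : forall l x, x \in `[a l, b l] -> 0 < w x.
Hypothesis w_cont : forall l, {within `[a l, b l], continuous w}.
Implicit Types (P : {poly R}) (N d : nat) (e : R).
Local Notation "'\int' f" :=
  (\int[lebesgue_measure]_(t in `[0, pi]) f t) (at level 36).
Local Notation g l P := (fun t => density (a l) (b l) w P (cos t)).

Lemma L1normE P :
  L1norm a b w P = \sum_l (b l - a l) / 2 * \int (fun t => `|g l P t|).
Proof.
apply: eq_bigr => l _.
by rewrite Rintegral_density//; exact: w_pos.
Qed.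

Lemma continuous_density_cos l P : {within `[0, pi], continuous (g l P)}.
Proof.
apply: within_continuous_comp_cos; apply: within_continuous_density => //.
exact: w_pos.
Qed.

Lemma ersatz_feasibleP N d P (yp ym : 'I_L.+1 -> 'cV[R]_d.+1) :
  (size P <= N.+1)%N -> ersatz_feasible a b w N P yp ym <->
  forall l, [/\ yp l - ym l = cos_moments d (g l P), psd (Toep (yp l))
              & psd (Toep (ym l))].
Proof.
move=> sP; have E l : chebJ a b w N d l *m chebW (a l) (b l) N *m
    polycoord N (@chebT R) P = cos_moments d (g l P).
  by rewrite -(@cos_moments_density R _ _ w (ab l) (@w_pos l) (@w_cont l) N d).
by split => h l; have := h l; rewrite E.
Qed.

Lemma ersatz_norm_le_L1norm N d P : (size P <= N.+1)%N ->
  ersatz_norm a b w N d P <= L1norm a b w P.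
Proof.
move=> sP; have [_] := ersatz_norm_min w N d P (fun l => ltW (ab l)).
apply.
have /choice[yp] l :=
  cos_moments_psd_decomposition d (@continuous_density_cos l P).
move=> /choice[ym hy]; exists yp, ym; split.
  by apply/ersatz_feasibleP => // l; have [] := hy l.
by rewrite L1normE; apply: eq_bigr => l _; have [_ _ _ ->] := hy l.
Qed.

(** One [D] serves all [P]: the Korovkin bound is used only for the finitely many pairs of an
    interval and a monomial, and everything is linear in the coefficients of [P]. *)
Lemma fejer_density_error N e : 0 < e ->
  exists D, forall d, (D <= d)%N -> forall l P x, (size P <= N.+1)%N ->
    x \in `[0, pi] ->
    `|g l P x - fejer (cos_moments d (g l P)) x| <= e * coef_norm N P.
Proof.
move=> e0.
have [D hD] : exists D, forall d, (D <= d)%N -> forall p : 'I_L.+1 * 'I_N.+1,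
    forall x, x \in `[0, pi] -> `|g p.1 'X^(p.2) x -
      fejer (cos_moments d (g p.1 'X^(p.2))) x| <= e.
  apply: eventually_all => -[l n] /=; apply: fejer_cvg => //.
  by apply: within_continuous_density => //; exact: w_pos.
exists D => d Dd l P x sP xI.
rewrite (_ : g l P = fun t => \sum_(n < N.+1) P`_n * g l 'X^n t); last first.
  by apply/funext => t; exact: density_sum.
rewrite cos_moments_sum; last by move=> n; exact: continuous_density_cos.
rewrite fejer_sum [density _ _ _ P _](density_sum _ _ _ _ sP) -sumrB mulr_sumr.
rewrite (le_trans (ler_norm_sum _ _ _))//.
apply: ler_sum => n _; rewrite -mulrBr normrM mulrC ler_wpM2r//.
exact: (hD d Dd (l, n)).
Qed.

Lemma L1norm_le_ersatz_norm N e : 0 < e ->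
  exists D, forall d, (D <= d)%N -> forall P, (size P <= N.+1)%N ->
    L1norm a b w P <= ersatz_norm a b w N d P + e * coef_norm N P.
Proof.
move=> e0; pose S := \sum_l (b l - a l) / 2.
have c0 l : 0 <= (b l - a l) / 2 by rewrite divr_ge0// subr_ge0 ltW.
have S0 : 0 <= S by exact: sumr_ge0.
have p0 : 0 < pi :> R := pi_gt0 R.
(* The intervals together contribute an error of [pi * S * e' * coef_norm N P]. Dividing by [1 + S]
   gives [pi * S * e' <= e] with a divisor that is clearly positive. *)
pose e' := e / (pi * (1 + S)).
have q0 : 0 < pi * (1 + S) by rewrite mulr_gt0// ltr_wpDr.
have e'0 : 0 < e' by rewrite divr_gt0.
have [D hD] := @fejer_density_error N e' e'0.
exists D => d Dd P sP.
(* As the minimum is attained, [ersatz_norm] is the objective at an actual feasible pair. *)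
have [[yp [ym [/ersatz_feasibleP -/(_ sP) hy ->]]] _] :=
  ersatz_norm_min w N d P (fun l => ltW (ab l)).
rewrite L1normE; apply: (@le_trans _ _ (\sum_l (b l - a l) / 2 *
    (yp l 0 0 + ym l 0 0 + e' * coef_norm N P * pi))).
  apply: ler_sum => l _; apply: ler_wpM2l => //; have [h1 h2 h3] := hy l.
  apply: le_cos_moments_psd h1 h2 h3 _; first exact: continuous_density_cos.
  by move=> x; exact: hD.
under eq_bigr do rewrite mulrDr.
rewrite big_split /= lerD2l -mulr_suml -/S.
have -> : S * (e' * coef_norm N P * pi) =
    (pi * S * e') * coef_norm N P by ring.
rewrite ler_wpM2r ?coef_norm_ge0// /e' mulrCA.
rewrite ler_piMr ?(ltW e0)// ler_pdivrMr// mul1r ler_pM2l//.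
by rewrite lerDr.
Qed.

End ErsatzBounds.

(** * Extraction of subsequences *)

Section Subsequences.
Implicit Types (f g : nat -> nat).

Lemma homo_ltn_leq f : {homo f : k m / (k < m)%N} -> forall k, (k <= f k)%N.
Proof.
by move=> hf; elim=> // k IH; apply: leq_ltn_trans IH (hf _ _ _).
Qed.

Lemma homo_ltn_cvgny f : {homo f : k m / (k < m)%N} -> f @ \oo --> \oo.
Proof.
move=> hf; apply/cvgnyPge => A; near=> k.
by apply: leq_trans (homo_ltn_leq hf k); near: k; exact: nbhs_infty_ge.
Unshelve. all: end_near. Qed.

Lemma frequently_subseq (P : nat -> Prop) :
  (forall n, exists k, (n <= k)%N /\ P k) ->
  exists2 f, {homo f : k m / (k < m)%N} & forall k, P (f k).
Proof.
move=> /choice[g gP].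
(* [g n] is an index at or after [n] where [P] holds; restarting from [(f m).+1] makes [f] strictly
   increasing. *)
pose f := fix f n := if n is m.+1 then g (f m).+1 else g 0%N.
exists f; last by case=> [|n]; exact: (gP _).2.
by apply: homo_ltn; [exact: ltn_trans|move=> n; exact: (gP _).1].
Qed.

End Subsequences.

(** * Compactness and equivalence of norms in bounded degree *)

Section CoefficientNorm.
Variable R : realType.
Implicit Types (P Q U : {poly R}) (N n : nat) (V : nat -> {poly R}).

Lemma coef_normN N P : coef_norm N (- P) = coef_norm N P.
Proof. by apply: eq_bigr => i _; rewrite coefN normrN. Qed.

Lemma coef_normZ N c P : coef_norm N (c *: P) = `|c| * coef_norm N P.
Proof. by rewrite mulr_sumr; apply: eq_bigr => i _; rewrite coefZ normrM. Qed.

Lemma coef_le_coef_norm N P i : (i < N.+1)%N -> `|P`_i| <= coef_norm N P.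
Proof.
by move=> iN; rewrite /coef_norm (bigD1 (Ordinal iN))//= lerDl sumr_ge0.
Qed.

Lemma coef_norm_eq0 N P : (size P <= N.+1)%N -> coef_norm N P = 0 -> P = 0.
Proof.
move=> sP P0; apply/polyP => i; rewrite coef0; have [iN|Ni] := ltnP i N.+1.
  by apply/eqP; rewrite -normr_le0 (le_trans (coef_le_coef_norm P iN))// P0.
by rewrite nth_default// (leq_trans sP).
Qed.

Lemma bounded_coef_subseq N V M : (forall k, (size (V k) <= N.+1)%N) ->
  (forall k, coef_norm N (V k) <= M) ->
  exists f U, [/\ {homo f : k m / (k < m)%N}, (size U <= N.+1)%N
    & coef_norm N (V (f k) - U) @[k --> \oo] --> (0 : R)].
Proof.
move=> sV VM.
have [f hf cf] : exists2 f, {homo f : k m / (k < m)%N} &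
    forall i, (i < N.+1)%N -> cvgn (fun k => (V (f k))`_i).
  have : (N.+1 <= N.+1)%N by [].
  (* Bolzano-Weierstrass is applied one coefficient at a time: [n] counts those already convergent
     along [f], and a further extraction keeps their limits. *)
  elim: {1 3}N.+1 => [_|n IH nN]; first by exists id.
  have [f hf cf] := IH (ltnW nN).
  have /bolzano_weierstrass[g gi gc] : bounded_fun (fun k => (V (f k))`_n).
    exists M; split; first exact: num_real.
    move=> x Mx k _; apply: le_trans (ltW Mx); apply: le_trans (VM (f k)).
    exact: coef_le_coef_norm.
  have hg : {homo g : k m / (k < m)%N}.
    by move=> k m; rewrite !ltnNge -!leEnat gi.
  exists (f \o g); first by move=> k m /hg/hf.
  move=> i; rewrite ltnS leq_eqVlt => /predU1P[->//|ni].
  have /cvg_ex[l fl] := cf i ni; apply/cvg_ex; exists l.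
  have ff := homo_ltn_cvgny hg.
  exact: (@cvg_comp _ _ _ g (fun k => (V (f k))`_i) _ _ _ ff fl).
exists f, (\poly_(i < N.+1) lim ((V (f k))`_i @[k --> \oo])); split => //.
pose l i := limn (fun k => (V (f k))`_i).
suff : coef_norm N (V (f k) - \poly_(i < N.+1) l i) @[k --> \oo] -->
    \sum_(i < N.+1) `|l i - l i|.
  by rewrite big1// => i _; rewrite subrr normr0.
apply: cvg_big => [|i _]; first exact: add_continuous.
under eq_fun do rewrite coefB coef_poly ltn_ord.
by apply: cvg_norm; apply: cvgB; [exact: (cf i (ltn_ord i))|exact: cvg_cst].
Qed.

Section PolyNorm.
Variables (N : nat) (nrm : {poly R} -> R).
Hypothesis nrmP : poly_norm N nrm.

Lemma poly_norm0 : nrm 0 = 0.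
Proof.
by case: nrmP => _ nZ _; rewrite -(scale0r 0) nZ ?size_poly0// normr0 mul0r.
Qed.

Lemma poly_normN P : (size P <= N.+1)%N -> nrm (- P) = nrm P.
Proof.
by case: nrmP => _ nZ _ sP; rewrite -scaleN1r nZ// normrN normr1 mul1r.
Qed.

Lemma poly_norm_ge0 P : (size P <= N.+1)%N -> 0 <= nrm P.
Proof.
move=> sP; have [_ _ nD] := nrmP; have := nD P (- P).
rewrite subrr poly_norm0 size_polyN poly_normN// => /(_ sP sP); lra.
Qed.

Lemma poly_norm_le_coef : exists2 K : R, 0 <= K & forall P,
  (size P <= N.+1)%N -> nrm P <= K * coef_norm N P.
Proof.
have [_ nZ nD] := nrmP.
have sX (i : 'I_N.+1) : (size ('X^i : {poly R}) <= N.+1)%N.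
  by rewrite size_polyXn ltn_ord.
exists (\sum_(i < N.+1) nrm 'X^i).
  by apply: sumr_ge0 => i _; exact: poly_norm_ge0.
move=> P sP.
have h (r : seq 'I_N.+1) : (size (\sum_(i <- r) P`_i *: 'X^i)%R <= N.+1)%N /\
    nrm (\sum_(i <- r) P`_i *: 'X^i) <= \sum_(i <- r) `|P`_i| * nrm 'X^i.
  elim: r => [|i r [IH1 IH2]]; first by rewrite !big_nil size_poly0 poly_norm0.
  have sZ : (size (P`_i *: 'X^i)%R <= N.+1)%N.
    by rewrite (leq_trans (size_scale_leq _ _)).
  rewrite !big_cons; split.
    by rewrite (leq_trans (size_polyD _ _))// geq_max sZ.
  by rewrite (le_trans (nD _ _ sZ IH1))// nZ// lerD2l.
have -> : nrm P = nrm (\sum_(i < N.+1) P`_i *: 'X^i).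
  congr nrm; apply/polyP => i; rewrite -poly_def coef_poly; case: ltnP => // Ni.
  by rewrite nth_default// (leq_trans sP).
rewrite (le_trans (h _).2)// mulr_suml; apply: ler_sum => i _.
rewrite mulrC ler_wpM2l ?poly_norm_ge0//.
exact: coef_le_coef_norm.
Qed.

(** Otherwise, rescaled counterexamples to each constant [k.+1] form a sequence with [coef_norm]
    equal to 1 and [nrm] tending to 0. A limit point [U] has [nrm U = 0], so [U = 0], whereas its
    coefficient norm should be 1. *)
Lemma coef_norm_le_poly_norm : exists2 C : R, 0 < C & forall P,
  (size P <= N.+1)%N -> coef_norm N P <= C * nrm P.
Proof.
have [n0 nZ nD] := nrmP; have [K K0 hK] := poly_norm_le_coef.
apply: contrapT => nC.
have /choice[Q hQ] : forall k : nat, exists Q, [/\ (size Q <= N.+1)%N,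
    coef_norm N Q = 1 & nrm Q <= k.+1%:R^-1].
  move=> k; apply: contrapT => nQ; apply: nC; exists k.+1%:R => // P sP.
  have [->|P0] := eqVneq P 0.
    rewrite poly_norm0 mulr0 /coef_norm big1// => i _.
    by rewrite coef0 normr0.
  rewrite leNgt; apply/negP => kP; apply: nQ.
  have cP : 0 < coef_norm N P.
    rewrite lt_def coef_norm_ge0 andbT; apply: contra_neq P0.
    exact: coef_norm_eq0.
  have cV : `|(coef_norm N P)^-1| = (coef_norm N P)^-1.
    by rewrite gtr0_norm// invr_gt0.
  exists ((coef_norm N P)^-1 *: P); split.
  - by rewrite (leq_trans (size_scale_leq _ _)).
  - by rewrite coef_normZ cV mulVf// gt_eqF.
  - rewrite nZ// cV mulrC ler_pdivrMr// mulrC ler_pdivlMr// mulrC.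
    exact: ltW.
have sQ k : (size (Q k) <= N.+1)%N by case: (hQ k).
have cQ k : coef_norm N (Q k) = 1 by case: (hQ k).
have [|f [U [hf sU fU]]] := @bounded_coef_subseq N Q 1 sQ.
  by move=> k; rewrite cQ.
have sD k : (size (U - Q (f k))%R <= N.+1)%N.
  by rewrite (leq_trans (size_polyD _ _))// geq_max size_polyN sU sQ.
have nU : nrm U = 0.
  apply/eqP; rewrite eq_le poly_norm_ge0// andbT.
  have lim0 : (fun k => K * coef_norm N (Q (f k) - U) + k.+1%:R^-1) @ \oo -->
      (0 : R).
    rewrite -[0]addr0; apply: cvgD; last exact: cvg_harmonic.
    by rewrite -(mulr0 K); apply: cvgMl_tmp.
  apply: (cvgr_to_ge lim0); near=> k.
  rewrite -[U in nrm U](subrK (Q (f k))) (le_trans (nD _ _ (sD _) (sQ _)))//.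
  apply: lerD; first by rewrite (le_trans (hK _ (sD _)))// -opprB coef_normN.
  have [_ _ /le_trans] := hQ (f k); apply.
  by rewrite lef_pV2 ?posrE// ler_nat ltnS homo_ltn_leq.
have {nU} U0 := n0 U sU nU.
have : 1 <= (0 : R).
  apply: (cvgr_to_ge fU); near=> k.
  by rewrite U0 subr0 cQ.
by rewrite ler10.
Unshelve. all: end_near. Qed.

(** Reduces convergence in every norm to convergence of coefficients. The degree bound is asked only
    eventually because the theorem constrains [V d] only for [d >= N]. *)
Lemma poly_norm_cvg V U : (size U <= N.+1)%N ->
  (\forall k \near \oo, (size (V k) <= N.+1)%N) ->
  coef_norm N (V k - U) @[k --> \oo] --> (0 : R) ->
  nrm (V k - U) @[k --> \oo] --> (0 : R).
Proof.
move=> sU sV cV; have [K K0 hK] := poly_norm_le_coef.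
apply: (@squeeze_cvgr _ _ _ _ (fun=> 0) (fun k => K * coef_norm N (V k - U))).
- near=> k.
  have sD : (size (V k - U)%R <= N.+1)%N.
    rewrite (leq_trans (size_polyD _ _))// geq_max size_polyN sU andbT.
    by near: k.
  by rewrite poly_norm_ge0// hK.
- exact: cvg_cst.
- by rewrite -(mulr0 K); apply: cvgMl_tmp.
Unshelve. all: end_near. Qed.

End PolyNorm.
End CoefficientNorm.

Lemma poly_eq0_itv (R : realType) (a b : R) (P : {poly R}) : a < b ->
  (forall x, x \in `]a, b[ -> P.[x] = 0) -> P = 0.
Proof.
move=> ab P0; apply/eqP; apply: contraT => PN0.
(* These points give [size P] distinct roots, too many for a nonzero [P]; starting at denominator 2
   keeps them strictly below [b]. *)
pose F (i : nat) : R := a + (b - a) / i.+2%:R.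
pose rs := map F (iota 0 (size P)).
have : (size rs < size P)%N.
  apply: max_poly_roots => //.
    apply/allP => _ /mapP[i _ ->]; rewrite /root P0// in_itv /= /F.
    have ba : 0 < b - a by rewrite subr_gt0.
    rewrite ltrDl divr_gt0//= -ltrBrDl ltr_pdivrMr// ltr_pMr// ltr1n//.
  rewrite map_inj_uniq ?iota_uniq// => i j /addrI /mulfI.
  rewrite gt_eqF ?subr_gt0// => /(_ isT) /invr_inj /eqP.
  by rewrite eqr_nat => /eqP[].
by rewrite size_map size_iota ltnn.
Qed.

(** * [L1norm] as a norm, and limit points of the ersatz minimizers *)

Section L1Norm.
Variables (R : realType) (L : nat) (a b : 'I_L.+1 -> R) (w : R -> R).
Hypothesis ab : forall l, a l < b l.
Hypothesis w_pos : forall l x, x \in `[a l, b l] -> 0 < w x.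
Hypothesis w_cont : forall l, {within `[a l, b l], continuous w}.
Implicit Types (P Q U : {poly R}) (N : nat).

Lemma within_continuous_weighted l P :
  {within `[a l, b l], continuous (fun t => `|P.[t]| / w t)}.
Proof.
apply: within_continuousM.
  apply: within_continuous_norm; apply: continuous_subspaceT.
  exact: continuous_horner.
by apply: within_continuousV => // x /w_pos/gt_eqF ->.
Qed.

Lemma weighted_ge0 l P t : t \in `[a l, b l] -> 0 <= `|P.[t]| / w t.
Proof. by move=> /w_pos wt; rewrite divr_ge0// ltW. Qed.

Lemma L1norm_poly_norm N : poly_norm N (L1norm a b w).
Proof.
split=> [P sP /eqP|c P _|P Q _ _].
- rewrite psumr_eq0 => [/allP/(_ ord0)|l _]; last first.
    by apply: Rintegral_ge0 => t; exact: weighted_ge0.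
  (* The first interval alone forces [P = 0]: the integrand vanishes on its interior. *)
  rewrite mem_index_enum => /(_ isT)/eqP P0.
  apply: (@poly_eq0_itv _ _ _ _ (ab ord0)) => x xI.
  have := itv_Rintegral_eq0 (ab ord0) (@within_continuous_weighted ord0 P)
    (@weighted_ge0 ord0 P) P0 xI.
  move=> /eqP; rewrite mulf_eq0 normr_eq0 invr_eq0 => /orP[/eqP //|].
  by rewrite gt_eqF// (w_pos (l := ord0))//; exact: subset_itv_oo_cc xI.
- rewrite mulr_sumr; apply: eq_bigr => l _; rewrite -itv_RintegralZ.
    by apply: eq_Rintegral => t _; rewrite hornerZ normrM mulrA.
  exact: within_continuous_weighted.
- rewrite -big_split; apply: ler_sum => l _ /=.
  have cP := @within_continuous_weighted l.
  rewrite -itv_RintegralD//; apply: le_itv_Rintegral => //.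
    exact: within_continuousD.
  move=> t tI; rewrite hornerD -mulrDl ler_wpM2r ?ler_normD//.
  by rewrite invr_ge0 ltW// (w_pos tI).
Qed.

(** An arbitrary index sequence [f] is allowed so that the uniqueness argument can extract from a
    subsequence that stays away from [U]. *)
Lemma monic_minimizer_subseq N (V : nat -> {poly R}) f :
  (forall d, (N <= d)%N -> monic_minimizer N (ersatz_norm a b w N d) (V d)) ->
  {homo f : k m / (k < m)%N} -> (forall k, (N <= f k)%N) ->
  exists g U, [/\ {homo g : k m / (k < m)%N},
    monic_minimizer N (L1norm a b w) U
    & coef_norm N (V (f (g k)) - U) @[k --> \oo] --> (0 : R)].
Proof.
move=> Vmin hf Nf.
have [C C0 hC] := coef_norm_le_poly_norm (L1norm_poly_norm N).
(* With this tolerance the error term is at most half of [L1norm], so it can be absorbed on the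
   left. *)
have e0 : 0 < (2 * C)^-1 by rewrite invr_gt0 mulr_gt0.
have [D hD] := @L1norm_le_ersatz_norm _ _ a b w ab w_pos w_cont N _ e0.
have sV d : (N <= d)%N -> size (V d) = N.+1 by move=> /Vmin[[]].
have le_ersatz d Q : (N <= d)%N -> monic_deg N Q ->
    ersatz_norm a b w N d (V d) <= L1norm a b w Q.
  move=> Nd mQ; have [_ /(_ _ mQ)/le_trans] := Vmin _ Nd; apply.
  by apply: ersatz_norm_le_L1norm => //; case: mQ => _ ->.
pose X : {poly R} := 'X^N.
have mX : monic_deg N X by split; [exact: monicXn|exact: size_polyXn].
(* Comparing [V d] with the competitor ['X^N] and absorbing the error gives
   [L1norm (V d) <= 2 * L1norm 'X^N]. *)
pose M := C * (2 * L1norm a b w X).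
(* The shift puts every index past [D], so that the bound [M] holds along all of [h]. *)
pose h k := f (k + D)%N.
have hh : {homo h : k m / (k < m)%N}.
  by move=> k m km; apply: hf; rewrite ltn_add2r.
have Nh k : (N <= h k)%N by exact: Nf.
have Dh k : (D <= h k)%N by rewrite (leq_trans (leq_addl k D))// homo_ltn_leq.
have VM k : coef_norm N (V (h k)) <= M.
  have sVk : (size (V (h k)) <= N.+1)%N by rewrite sV// Nh.
  have := hD _ (Dh k) _ sVk; have := hC _ sVk.
  have := le_ersatz (h k) X (Nh _) mX; rewrite /M.
  set x := coef_norm _ _; set y := L1norm _ _ _ (V _); move=> h1 h2 h3.
  rewrite (le_trans h2)// ler_pM2l//.
  have : (2 * C)^-1 * x <= y / 2.
    rewrite ler_pdivrMl ?mulr_gt0//.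
    by have -> : 2 * C * (y / 2) = C * y by field.
  lra.
have [|g [U [hg sU gU]]] := bounded_coef_subseq _ VM.
  by move=> k; rewrite sV// Nh.
exists (fun k => (g k + D)%N), U; split => //.
  by move=> k m /hg; rewrite ltn_add2r.
(* The coefficient of order [N] passes to the limit, so [U] is again monic of degree [N]. *)
have UN : U`_N = 1.
  apply/eqP; rewrite eq_sym -subr_eq0 -normr_le0.
  apply: (cvgr_to_ge gU); near=> k.
  apply: le_trans (coef_le_coef_norm _ (ltnSn N)).
  rewrite coefB; have [mV _] := (Vmin _ (Nf (g k + D)%N)).1.
  by move: mV; rewrite monicE lead_coefE sV ?Nf//= => /eqP ->.
have sU' : size U = N.+1.
  apply/eqP; rewrite eqn_leq sU /= ltnNge; apply/negP => /leq_sizeP/(_ N).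
  by rewrite UN => /(_ (leqnn _))/eqP; rewrite oner_eq0.
split; first by split => //; rewrite monicE lead_coefE sU' UN.
(* For large [k], replacing [U] by [V (h (g k))] costs [e / 2], and passing from [L1norm] to the
   ersatz norm, which is at most [L1norm Q] there, costs another [e / 2]. *)
move=> Q mQ; apply/ler_addgt0Pr => e ee0.
have M0 : 0 <= M by exact: le_trans (coef_norm_ge0 _ _) (VM 0%N).
(* Multiplied by a coefficient norm of at most [M], this stays below [e / 2]; the [+ 1] covers
   [M = 0]. *)
have e20 : 0 < e / 2 / (M + 1) by rewrite !divr_gt0// ltr_wpDl.
have [D' hD'] := @L1norm_le_ersatz_norm _ _ a b w ab w_pos w_cont N _ e20.
have nL := L1norm_poly_norm N.
have sW k : (size (V (h (g k))) <= N.+1)%N by rewrite sV// Nh.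
have lU : \forall k \near \oo, `|L1norm a b w (V (h (g k)) - U)| < e / 2.
  apply: cvgr0_norm_lt; last by rewrite divr_gt0.
  by apply: (poly_norm_cvg nL) gU => //; exact: nearW.
have lD' : \forall k \near \oo, (D' <= k)%N by exact: nbhs_infty_ge.
have [k [/= Uk D'k]] := filter_ex (filterI lU lD').
have D'h : (D' <= h (g k))%N.
  apply: (leq_trans D'k); apply: (leq_trans (homo_ltn_leq hg k)).
  exact: homo_ltn_leq hh (g k).
have [_ _ nD] := nL.
have sD : (size (U - V (h (g k)))%R <= N.+1)%N.
  by rewrite (leq_trans (size_polyD _ _))// geq_max size_polyN sU sW.
have := nD _ _ sD (sW k); rewrite subrK => /le_trans; apply.
have sD' : (size (V (h (g k)) - U)%R <= N.+1)%N by rewrite -size_polyN opprB.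
rewrite addrC [e]splitr addrA; apply: lerD; last first.
  by rewrite -opprB (poly_normN nL)// (le_trans (ler_norm _))// ltW.
apply: (le_trans (hD' _ D'h _ (sW k))); apply: lerD.
  exact: le_ersatz (Nh _) mQ.
apply: le_trans (ler_wpM2l (ltW e20) (VM _)) _.
by rewrite mulrAC ler_pdivrMr ?ltr_wpDl// ler_pM2l ?divr_gt0// lerDl.
Unshelve. all: end_near. Qed.

End L1Norm.

Theorem theorem5 (R : realType) (L : nat) (a b : 'I_L.+1 -> R) (w : R -> R)
    (N : nat) (V : nat -> {poly R})
    (a_first : a ord0 = -1) (b_last : b ord_max = 1)
    (ab : forall l, a l < b l)
    (ba : forall l m : 'I_L.+1, l.+1 = m :> nat -> b l < a m)
    (w_pos : forall x, union_itv a b x -> 0 < w x)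
    (w_cont : {within union_itv a b, continuous w})
    (V_min : forall d, (N <= d)%N ->
       monic_minimizer N (ersatz_norm a b w N d) (V d)) :
  (exists (phi : nat -> nat) (U : {poly R}),
     [/\ {homo phi : k m / (k < m)%N},
         forall k, (N <= phi k)%N,
         monic_minimizer N (L1norm a b w) U
       & poly_cvg N (V \o phi) U]) /\
  (forall U : {poly R},
     monic_minimizer N (L1norm a b w) U ->
     (forall P, monic_minimizer N (L1norm a b w) P -> P = U) ->
     poly_cvg N V U).
Proof.
have w_posl l x : x \in `[a l, b l] -> 0 < w x.
  by move=> xl; apply: w_pos; exists l.
have w_contl l : {within `[a l, b l], continuous w}.
  by apply: continuous_subspaceW w_cont => x xl; exists l.
have subseq := monic_minimizer_subseq ab w_posl w_contl V_min.
have sV d : (N <= d)%N -> (size (V d) <= N.+1)%N.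
  by move=> /V_min[[_ ->]].
split=> [|U minU Uuniq].
  (* The index sequence [N + k] skips the terms of [V] before [N]. *)
  have [|k|g [U [hg minU VU]]] := subseq (addn N).
  - by move=> k m; rewrite ltn_add2l.
  - exact: leq_addr.
  exists (addn N \o g), U; split => //.
  - by move=> k m /hg; rewrite /= ltn_add2l.
  - by move=> k; exact: leq_addr.
  move=> nrm nrmP; apply: (poly_norm_cvg nrmP) VU.
  - by case: minU => -[_ ->].
  - by apply: nearW => k; apply: sV; exact: leq_addr.
have sU : (size U <= N.+1)%N by case: minU => -[_ ->].
move=> nrm nrmP; apply: (poly_norm_cvg nrmP) => //.
  by near=> k; apply: sV; near: k; exact: nbhs_infty_ge.
(* If convergence fails, some subsequence stays at distance at least [e] from [U]; it has a further
   subsequence tending to a minimizer, which is [U] by uniqueness. *)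
apply/cvgrPdist_lt => e e0; apply: contrapT => nV.
have [n|f hf fV] := @frequently_subseq (fun k =>
    (N <= k)%N /\ e <= coef_norm N (V k - U)).
  apply: contrapT => nk; apply: nV; near=> k.
  rewrite sub0r normrN ger0_norm ?coef_norm_ge0// ltNge; apply/negP => ek.
  apply: nk; exists k; split; first by near: k; exact: nbhs_infty_ge.
  by split => //; near: k; exact: nbhs_infty_ge.
have [|g [U' [hg minU' VU']]] := subseq f hf; first by move=> k; case: (fV k).
rewrite (Uuniq _ minU') in VU'.
have : e <= (0 : R).
  by apply: (cvgr_to_ge VU'); near=> k; case: (fV (g k)).
by rewrite leNgt e0.
Unshelve. all: end_near. Qed.
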